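(* Let $\vec G_1$ and $\vec G_2$ be the two linear orientations of the Coxeter diagram $s_0\overset{4}{-}s_1-\cdots-s_{n-1}$ of $B_n$ (all arrows pointing in the same direction along the path). Then the set of signed permutations avoiding the signed patterns $-2\,-1$, $2\,-1$, $-2\,3\,1$, $-1\,2\,-3$, $1\,2\,-3$ and $2\,3\,1$ is a sublattice of the weak order on $B_n$ isomorphic to one of $\mathcal C(\vec G_1),\mathcal C(\vec G_2)$, and the set of signed permutations avoiding $-2\,1$, $1\,-2$, $-2\,-1\,-3$, $-1\,3\,-2$, $3\,-1\,2$ and $3\,1\,2$ is a sublattice of the weak order on $B_n$ isomorphic to the other.
   Context: $B_n$: signed permutations $x$ of $\pm[n]$ with $x(-i)=-x(i)$, written in abbreviated notation $x_1,\dots,x_n$ ($x_i=x(i)$); generators $s_0=(-1\ 1)$, $s_i=(i\ i{+}1)(-i{-}1\ {-i})$. Weak order $v\le w$ iff $I(v)\subseteq I(w)$, $I(w)$ the reflections $t$ with $\ell(tw)<\ell(w)$. $\Theta(\vec G)$: smallest lattice congruence of the weak order with $t$ congruent to the element with word $tsts\cdots$ of $m(s,t)-1$ letters for each directed edge $s\to t$ ($m(s_0,s_1)=4$, otherwise $3$); $\mathcal C(\vec G)$ is the quotient lattice. Signed pattern avoidance: for a sequence $(a_1,\dots,a_p)$ of nonzero integers with distinct absolute values, $\mathrm{st}(a_1,\dots,a_p)$ is the signed permutation $y\in B_p$ with $y_i<0$ iff $a_i<0$ and $|y_i|<|y_j|$ iff $|a_i|<|a_j|$. A signed permutation $x$ contains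 the signed pattern $y$ if some subsequence of its abbreviated notation $x_1,\dots,x_n$ has standardization $y$; otherwise it avoids $y$. Patterns are written in abbreviated notation, e.g. $-2\,3\,1$ is the element of $B_3$ with $y_1=-2,y_2=3,y_3=1$. *)

(* Defs.v *)
From mathcomp Require Import all_boot all_order all_fingroup all_algebra.
Set Implicit Arguments. Unset Strict Implicit. Unset Printing Implicit Defensive.
Import GRing.Theory Num.Theory.
Local Open Scope ring_scope.

(* ---------- Signed permutations of +-[n] ----------
   The point (i, b) : 'I_n * bool stands for  (i+1)  if b = false
   and for  -(i+1)  if b = true.  A signed permutation is a permutation x
   of these 2n points with x(-a) = -x(a).  Products: mathcomp's
   (u * v)%g applies u first, so the composite  t o w  (t after w) is
   (w * t)%g. *)

Definition pt (n : nat) := ('I_n * bool)%type.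

Definition negpt (n : nat) (a : pt n) : pt n := (a.1, ~~ a.2).

Definition ptval (n : nat) (a : pt n) : int :=
  if a.2 then - (a.1.+1 : nat)%:Z else (a.1.+1 : nat)%:Z.

Definition Bn (n : nat) : {set {perm pt n}} :=
  [set x : {perm pt n} | [forall a : pt n, x (negpt a) == negpt (x a)]].

(* a permutation from a function (identity if the function is not injective;
   it is only applied to injective functions below) *)
Definition mkperm (T : finType) (f : T -> T) : {perm T} :=
  match @idP (injectiveb f) with
  | ReflectT H => perm (injectiveP _ H)
  | ReflectF _ => 1%g
  end.

(* s_0 = (-1 1);  s_k = (k k+1)(-k-1 -k) for 1 <= k <= n-1 *)
Definition gen_fun (n k : nat) (a : pt n) : pt n :=
  if k == 0%N then (if val a.1 == 0%N then negpt a else a)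
  else
    let m := val a.1 in
    let m' := if m == k.-1 then k else if m == k then k.-1 else m in
    (insubd a.1 m', a.2).

Definition gen (n k : nat) : {perm pt n} := mkperm (@gen_fun n k).

Definition gens (n : nat) : {set {perm pt n}} := [set gen n (val k) | k : 'I_n].

Fixpoint prods (n k : nat) : {set {perm pt n}} :=
  match k with
  | 0 => [set 1%g]
  | k'.+1 => [set (x * s)%g | x in prods n k', s in gens n]
  end.

Definition has_len (n : nat) (w : {perm pt n}) (k : nat) : Prop :=
  w \in prods n k /\ forall j, (j < k)%N -> w \notin prods n j.

Definition len_lt (n : nat) (u w : {perm pt n}) : Prop :=
  exists k l, [/\ has_len u k, has_len w l & (k < l)%N].

Definition refl (n : nat) (t : {perm pt n}) : Prop :=
  exists x s, [/\ x \in Bn n, s \in gens n & t = (x^-1 * s * x)%g].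

(* t \in I(w)  iff  l(t w) < l(w)  (t w = t o w = (w * t)%g) *)
Definition inv_set (n : nat) (w t : {perm pt n}) : Prop :=
  refl t /\ len_lt (w * t)%g w.

Definition wle (n : nat) (v w : {perm pt n}) : Prop :=
  forall t, inv_set v t -> inv_set w t.

Definition is_join (n : nat) (x y z : {perm pt n}) : Prop :=
  [/\ z \in Bn n, wle x z, wle y z &
      forall u, u \in Bn n -> wle x u -> wle y u -> wle z u].

Definition is_meet (n : nat) (x y z : {perm pt n}) : Prop :=
  [/\ z \in Bn n, wle z x, wle z y &
      forall u, u \in Bn n -> wle u x -> wle u y -> wle u z].

Definition sublattice (n : nat) (L : {set {perm pt n}}) : Prop :=
  L \subset Bn n /\
  forall x y, x \in L -> y \in L ->
    (exists2 z, z \in L & is_join x y z) /\ (exists2 z, z \in L & is_meet x y z).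

Definition is_lat_cong (n : nat) (R : {perm pt n} -> {perm pt n} -> Prop) : Prop :=
  [/\ (forall x y, R x y -> x \in Bn n /\ y \in Bn n),
      (forall x, x \in Bn n -> R x x),
      (forall x y, R x y -> R y x),
      (forall x y z, R x y -> R y z -> R x z) &
      ((forall x y z j1 j2, z \in Bn n -> R x y ->
          is_join x z j1 -> is_join y z j2 -> R j1 j2) /\
      (forall x y z m1 m2, z \in Bn n -> R x y ->
          is_meet x z m1 -> is_meet y z m2 -> R m1 m2))].

(* m(s_i,s_j) - 1 letters of the alternating word t s t ... for the edge s -> t
   (s = s_i, t = s_j); m = 4 for the edge {s_0,s_1}, else 3.
   As a function composition  t s = (s * t)%g,  t s t = (t * s * t)%g. *)
Definition dword (n i j : nat) : {perm pt n} :=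
  let s := gen n i in let t := gen n j in
  if (i == 0%N) || (j == 0%N) then (t * s * t)%g else (s * t)%g.

Definition Theta (n : nat) (E : nat -> nat -> bool) (x y : {perm pt n}) : Prop :=
  forall R, is_lat_cong R ->
    (forall i j, E i j -> R (gen n j) (dword n i j)) -> R x y.

Definition edges1 (n : nat) (i j : nat) : bool := (j == i.+1) && (j < n)%N.
Definition edges2 (n : nat) (i j : nat) : bool := (i == j.+1) && (i < n)%N.

(* order of the quotient lattice: [a] <= [b] iff [a] \/ [b] = [b] *)
Definition qle (n : nat) (E : nat -> nat -> bool) (a b : {perm pt n}) : Prop :=
  exists2 j, is_join a b j & Theta E j b.

(* L (with the weak order) is isomorphic to C(G) = B_n / Theta(G):
   f picks a representative of a class for each element of L. *)
Definition iso_to_quot (n : nat) (L : {set {perm pt n}}) (E : nat -> nat -> bool) : Prop :=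
  exists f : {perm pt n} -> {perm pt n},
    [/\ (forall x, x \in L -> f x \in Bn n),
        (forall y, y \in Bn n -> exists2 x, x \in L & Theta E (f x) y) &
        (forall x y, x \in L -> y \in L -> (wle x y <-> qle E (f x) (f y)))].

Definition abbr (n : nat) (x : {perm pt n}) : seq int :=
  [seq ptval (x (i, false)) | i <- enum 'I_n].

(* st(a) = y, for y a signed permutation in abbreviated notation *)
Definition std_eq (a y : seq int) : bool :=
  (size a == size y) &&
  [forall i : 'I_(size a),
     ((a`_i < 0) == (y`_i < 0)) &&
     [forall j : 'I_(size a),
        ((absz (nth (0:int) a i) < absz (nth (0:int) a j))%N == (absz (nth (0:int) y i) < absz (nth (0:int) y j))%N)]].

Definition contains (n : nat) (x : {perm pt n}) (y : seq int) : bool :=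
  [exists m : n.-tuple bool, std_eq (mask m (abbr x)) y].

Definition avoids_all (n : nat) (pats : seq (seq int)) : {set {perm pt n}} :=
  [set x in Bn n | all (fun y => ~~ contains x y) pats].

Definition pats1 : seq (seq int) :=
  [:: [:: -2; -1]; [:: 2; -1]; [:: -2; 3; 1]; [:: -1; 2; -3];
      [:: 1; 2; -3]; [:: 2; 3; 1]].

Definition pats2 : seq (seq int) :=
  [:: [:: -2; 1]; [:: 1; -2]; [:: -2; -1; -3]; [:: -1; 3; -2];
      [:: 3; -1; 2]; [:: 3; 1; 2]].

(* Main.v *)
Require Import Defs.
From mathcomp Require Import all_boot all_order all_fingroup all_algebra.
From mathcomp Require Import zify.

(* Write inv w a c when a < c are values and c is placed before a in the full
   notation w(-n) ... w(-1) w(1) ... w(n).  The weak order is inclusion of these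
   inversion sets, and they are exactly the transitive, co-transitive and
   centrally symmetric sets of pairs.  In full notation the six patterns of the
   first list mean: no a < b < c with b > 0 placed in the order b c a; those of
   the second list: the same with b < 0 (equivalently c a b with b > 0).  So both
   classes are described by "(a, c) inverted forces (b, c), or (a, b), inverted,
   according to the sign of b", a condition stable under intersections and under
   transitive closures of unions: both classes are sublattices.

   For the quotient by the edges s_{i+1} -> s_i: every congruence R containing
   the generating pairs relates the two ends of each cover that exchanges
   adjacent values a c into c a with some b > 0, a < b < c, placed before them
   (joining a generating pair with longest elements of parabolic subgroups, then
   restricting by meets and joins); hence every element is congruent to one of
   the first class.  Conversely, sending an element to the largest element of the
   class below it ("interior") is a lattice congruence containing the generating
   pairs and injective on the class.  The other orientation is transported by the
   anti-automorphism w |-> -w. *)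

Set Implicit Arguments. Unset Strict Implicit. Unset Printing Implicit Defensive.
Import Order.TTheory GRing.Theory Num.Theory.
Local Open Scope ring_scope.

(** * Signed permutations and inversions *)

Section Points.
Variable n : nat.
Implicit Types (a b c e f p q r : pt n) (w x y z s t : {perm pt n}).

Lemma negptK : involutive (@negpt n).
Proof. by case=> i b; rewrite /negpt /= negbK. Qed.

Lemma ptval_neg a : ptval (negpt a) = - ptval a.
Proof. by case: a => i [] //=; rewrite /ptval /= opprK. Qed.

Lemma ptval_inj : injective (@ptval n).
Proof.
by move=> [i b] [j d]; rewrite /ptval; case: b; case: d => /= E; congr (_, _);
  try apply: val_inj => /=; lia.
Qed.

Lemma ptval_neq0 a : ptval a <> 0.
Proof. by case: a => i []; rewrite /ptval /=; lia. Qed.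

Lemma ptval_bound a : - n%:Z <= ptval a <= n%:Z.
Proof. by case: a => i []; rewrite /ptval /=; have := ltn_ord i; lia. Qed.

Lemma ptval_onto (k : int) : k <> 0 -> - n%:Z <= k <= n%:Z -> exists a, ptval a = k.
Proof.
move=> k0 kn; have H : (`|k|.-1 < n)%N by lia.
by exists (Ordinal H, k < 0); rewrite /ptval /=; case: ltP; lia.
Qed.

Definition inv w a c :=
  (ptval a < ptval c) && (ptval (w^-1%g c) < ptval (w^-1%g a)).

Lemma BnP w : reflect (forall a, w (negpt a) = negpt (w a)) (w \in Bn n).
Proof. by rewrite inE; apply: (iffP forallP) => H a; apply/eqP; rewrite ?H //; apply/eqP. Qed.

Lemma Bn1 : 1%g \in Bn n.
Proof. by apply/BnP => a; rewrite !perm1. Qed.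

Lemma BnM w x : w \in Bn n -> x \in Bn n -> (w * x)%g \in Bn n.
Proof. by move=> /BnP Hw /BnP Hx; apply/BnP => a; rewrite !permM Hw Hx. Qed.

Lemma BnV w : w \in Bn n -> w^-1%g \in Bn n.
Proof. by move=> /BnP Hw; apply/BnP => a; apply: (@perm_inj _ w); rewrite Hw !permKV. Qed.

Lemma pos_neg w a : w \in Bn n -> ptval (w^-1%g (negpt a)) = - ptval (w^-1%g a).
Proof. by move=> /BnV /BnP ->; rewrite ptval_neg. Qed.

(** The shape of every reflection of $B_n$. The case [c = negpt a] is included: the four points then
    collapse to two, as for $s_0$ and its conjugates. *)
Definition swaps t a c :=
  [/\ t a = c, t c = a, t (negpt a) = negpt c, t (negpt c) = negpt a &
      forall e, e != a -> e != c -> e != negpt a -> e != negpt c -> t e = e].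

Lemma swaps_inj t s a c : swaps t a c -> swaps s a c -> t = s.
Proof.
move=> [t1 t2 t3 t4 t5] [s1 s2 s3 s4 s5]; apply/permP => e.
case: (eqVneq e a) => [->|?]; first by rewrite t1.
case: (eqVneq e c) => [->|?]; first by rewrite t2.
case: (eqVneq e (negpt a)) => [->|?]; first by rewrite t3.
case: (eqVneq e (negpt c)) => [->|?]; first by rewrite t4.
by rewrite t5 // s5.
Qed.

Lemma swaps_conj x t a c : x \in Bn n -> swaps t a c -> swaps (x^-1 * t * x)%g (x a) (x c).
Proof.
move=> xB [t1 t2 t3 t4 t5]; have /BnP xN := xB.
have xK e : (x^-1 * t * x)%g (x e) = x (t e) by rewrite !permM permK.
split; rewrite -?xN ?xK ?t1 ?t2 ?t3 ?t4 // => e e1 e2 e3 e4.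
rewrite -(permKV x e) xK; congr (x _); apply: t5.
- by apply: contraNneq e1 => <-; rewrite permKV.
- by apply: contraNneq e2 => <-; rewrite permKV.
- by apply: contraNneq e3 => <-; rewrite permKV.
- by apply: contraNneq e4 => <-; rewrite permKV.
Qed.

Lemma swapsC t a c : swaps t a c -> swaps t c a.
Proof. by move=> [t1 t2 t3 t4 t5]; split=> // e *; apply: t5. Qed.

Lemma swapsN t a c : swaps t a c -> swaps t (negpt a) (negpt c).
Proof. by move=> [t1 t2 t3 t4 t5]; split=> //; rewrite ?negptK // => e *; apply: t5. Qed.

(* gen n k exchanges hi k = k+1 and lo k = k (or -1 when k = 0). *)
Definition hi (k : 'I_n) : pt n := (k, false).
Definition lo (k : 'I_n) : pt n :=
  if nat_of_ord k == 0%N then (k, true) else (insubd k k.-1, false).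

Lemma ptval_hi k : ptval (hi k) = k.+1%:Z.
Proof. by []. Qed.

Lemma ptval_lo k : ptval (lo k) = if nat_of_ord k == 0%N then -1 else k%:Z.
Proof.
rewrite /lo /ptval; case: eqP => [/= ->//|/= k0].
by rewrite val_insubd (leq_ltn_trans (leq_pred _) (ltn_ord k)); lia.
Qed.

Lemma mkpermE (T : finType) (g : T -> T) : injective g -> mkperm g =1 g.
Proof.
move=> gi e; rewrite /mkperm.
(* [mkperm] matches on the term [idP] itself, so the goal is generalized over that proof in the
   [return] clause. *)
refine (match @idP (injectiveb g) as r in reflect _ _ return
  (match r with ReflectT H => perm (injectiveP g H) | ReflectF _ => 1%g end) e = g e
  with ReflectT H => permE _ _ | ReflectF H => _ end).
by case: H; apply/injectiveP.
Qed.

(** Generators become case distinctions on integers that [lia] can close. For [k = 0] one has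
    [lo k = negpt (hi k)], and the last two tests repeat the first two. *)
Lemma ptval_gen_fun (k : 'I_n) a : ptval (gen_fun k a) =
  if ptval a == ptval (hi k) then ptval (lo k) else
  if ptval a == ptval (lo k) then ptval (hi k) else
  if ptval a == - ptval (hi k) then - ptval (lo k) else
  if ptval a == - ptval (lo k) then - ptval (hi k) else ptval a.
Proof.
rewrite ptval_hi ptval_lo /gen_fun; case: a => i b.
case: (eqVneq (nat_of_ord k) 0%N) => k0 /=; rewrite ?k0.
  by case: (eqVneq (nat_of_ord i) 0%N) => i0; case: b; rewrite /ptval /= ?i0 /= ?(negPf i0) /=;
    repeat (case: eqP => ?); lia.
have kn := ltn_ord k; have in_ := ltn_ord i.
rewrite /ptval /= val_insubd; case: b => /=;
repeat (case: eqP => ?); case: ifP; lia.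
Qed.

Lemma gen_fun_inj (k : 'I_n) : injective (@gen_fun n k).
Proof.
move=> a c /(congr1 (@ptval n)); rewrite !ptval_gen_fun => H; apply: ptval_inj.
move: H; rewrite ptval_hi ptval_lo; case: (eqVneq (nat_of_ord k) 0%N) => k0;
  by repeat (case: eqP => ?); lia.
Qed.

Lemma ptval_gen (k : 'I_n) a : ptval (gen n k a) =
  if ptval a == ptval (hi k) then ptval (lo k) else
  if ptval a == ptval (lo k) then ptval (hi k) else
  if ptval a == - ptval (hi k) then - ptval (lo k) else
  if ptval a == - ptval (lo k) then - ptval (hi k) else ptval a.
Proof. by rewrite /gen (mkpermE (@gen_fun_inj k)) ptval_gen_fun. Qed.

Lemma gen_Bn (k : 'I_n) : gen n k \in Bn n.
Proof.
apply/BnP => a; apply: ptval_inj; rewrite ptval_neg !ptval_gen ptval_neg ptval_hi ptval_lo.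
by have := @ptval_neq0 a; case: (eqVneq (nat_of_ord k) 0%N) => k0; repeat (case: eqP => ?); lia.
Qed.

Lemma gen_swaps (k : 'I_n) : swaps (gen n k) (lo k) (hi k).
Proof.
split; try (apply: ptval_inj; rewrite ?ptval_neg ptval_gen ?ptval_neg ptval_hi ptval_lo;
  by case: (eqVneq (nat_of_ord k) 0%N) => k0; repeat (case: eqP => ?); lia).
move=> e e1 e2 e3 e4; apply: ptval_inj; rewrite ptval_gen.
have H d : e != d -> (ptval e == ptval d) = false.
  by move=> ed; apply: contraNF ed => /eqP/ptval_inj ->.
by rewrite -!ptval_neg !H.
Qed.

Lemma genK (k : 'I_n) a : gen n k (gen n k a) = a.
Proof.
apply: ptval_inj; have := ptval_gen k (gen n k a); have := ptval_gen k a.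
move: (ptval (gen n k _)) (ptval (gen n k a)) => P Q; rewrite ptval_hi ptval_lo.
by case: (eqVneq (nat_of_ord k) 0%N) => k0; repeat (case: eqP => ?); lia.
Qed.

Lemma genM (k : 'I_n) : (gen n k * gen n k = 1)%g.
Proof. by apply/permP => a; rewrite permM genK perm1. Qed.

Lemma genV (k : 'I_n) : (gen n k)^-1%g = gen n k.
Proof. by apply/eqP; rewrite eq_invg_mul genM. Qed.

Lemma pos_gen w (k : 'I_n) a : ((gen n k * w)^-1)%g a = gen n k (w^-1%g a).
Proof. by rewrite invMg permM genV. Qed.

(** The orbit of the pair (a, c) under the central symmetry of the full notation, that is, the set
    of inversions gained in one cover of the weak order. *)
Definition orbp a c e f := ((e == a) && (f == c)) || ((e == negpt c) && (f == negpt a)).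

Lemma eq_ptval a c : (a == c) = (ptval a == ptval c).
Proof. by apply/eqP/eqP => [->//|]; apply: ptval_inj. Qed.

Lemma orbpE a c e f : orbp a c e f =
  ((ptval e == ptval a) && (ptval f == ptval c)) ||
  ((ptval e == - ptval c) && (ptval f == - ptval a)).
Proof. by rewrite /orbp !eq_ptval !ptval_neg. Qed.

Lemma orbp_refl a c : orbp a c a c.
Proof. by rewrite /orbp !eqxx. Qed.

Lemma ptval_lt_lohi (k : 'I_n) : ptval (lo k) < ptval (hi k).
Proof. by rewrite ptval_lo ptval_hi; case: eqP; lia. Qed.

(** No nonzero integer lies between [lo k] and [hi k], so exchanging them (and their negatives)
    alters the comparison of [p] and [q] only when these form that pair or its mirror image. *)
Lemma gen_lt (k : 'I_n) p q : p != q ->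
  (ptval (gen n k p) < ptval (gen n k q)) =
  (ptval p < ptval q) (+) (orbp (lo k) (hi k) p q || orbp (hi k) (lo k) p q).
Proof.
rewrite eq_ptval !orbpE; have := @ptval_neq0 p; have := @ptval_neq0 q.
have := ptval_gen k p; have := ptval_gen k q.
move: (ptval (gen n k _)) (ptval (gen n k q)) (ptval p) (ptval q) => P' Q' P Q.
rewrite ptval_hi ptval_lo; move: (nat_of_ord k) => m.
case: (eqVneq m 0%N) => k0 /=; first by
  move=> H1 H2; move: H1 H2; do 4 (case: eqP => ?); do 4 (case: eqP => ?); lia.
by move=> H1 H2; move: H1 H2; do 4 (case: eqP => ?); do 4 (case: eqP => ?); lia.
Qed.

Lemma orbpC a c e f : orbp a c e f = orbp c a f e.
Proof. by rewrite /orbp andbC [(e == _) && (f == negpt _)]andbC. Qed.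

(** In [gen n k * w] the generator is applied first, hence acts on places: it exchanges two
    neighbouring entries of the full notation, and their mirror images. *)
Lemma inv_gen w (k : 'I_n) : w \in Bn n -> ptval (w (lo k)) < ptval (w (hi k)) ->
  forall e f, inv (gen n k * w)%g e f = inv w e f || orbp (w (lo k)) (w (hi k)) e f.
Proof.
move=> wB lt e f; rewrite /inv !pos_gen -(permKV w e) -(permKV w f).
set p := w^-1%g e; set q := w^-1%g f; rewrite !permK.
case: (eqVneq p q) => [->|pq].
  rewrite ltxx /= orbpE; lia.
have /BnP wN := wB.
rewrite gen_lt 1?eq_sym //.
have -> : orbp (w (lo k)) (w (hi k)) (w p) (w q) = orbp (lo k) (hi k) p q.
  by rewrite /orbp -!wN !(inj_eq perm_inj).
have orb_lt (g : pt n -> pt n) r r' : (forall a, g (negpt a) = negpt (g a)) ->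
    ptval (g (lo k)) < ptval (g (hi k)) -> orbp (lo k) (hi k) r r' -> ptval (g r) < ptval (g r').
  by move=> gN glt /orP[] /andP[/eqP -> /eqP ->] //; rewrite !gN !ptval_neg ltrN2.
rewrite [orbp (hi k) _ _ _]orbpC.
case: (boolP (orbp (lo k) (hi k) p q)) => [O2|_].
  rewrite (orb_lt w _ _ wN lt O2) orbT.
  by rewrite ltNge (ltW (orb_lt id _ _ _ (ptval_lt_lohi k) O2)).
rewrite orbF; case: (boolP (orbp (lo k) (hi k) q p)) => [O1|_]; last by rewrite addbF orbF.
by rewrite [_ < ptval (w q)]ltNge (ltW (orb_lt w _ _ wN lt O1)).
Qed.

End Points.

(** * Lengths, reflections and the weak order *)

Section Words.
Variable n : nat.
Implicit Types (a b c e f p q r : pt n) (w x y z s t : {perm pt n}) (k : 'I_n).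

Lemma mem_gens s : reflect (exists k, s = gen n k) (s \in gens n).
Proof. by apply: (iffP imsetP) => [[k _ ->]|[k ->]]; exists k. Qed.

Lemma prods_rec m w : reflect (exists k w', w' \in prods n m /\ w = (w' * gen n k)%g)
  (w \in prods n m.+1).
Proof.
apply: (iffP imset2P) => [[w' s Hw' /mem_gens[k ->] ->]|[k [w' [Hw' ->]]]].
  by exists k, w'.
by exists w' (gen n k) => //; apply/mem_gens; exists k.
Qed.

(** Words in [prods] grow on the right, whereas [inv_gen] describes multiplication on the left. *)
Lemma prods_recl m w : w \in prods n m.+1 <->
  exists k w', w' \in prods n m /\ w = (gen n k * w')%g.
Proof.
elim: m w => [|m IH] w; split.
- case/prods_rec => k [w' []]; rewrite inE => /eqP -> ->.
  by exists k, 1%g; rewrite inE mul1g mulg1.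
- case=> k [w' []]; rewrite inE => /eqP -> ->; apply/prods_rec.
  by exists k, 1%g; rewrite inE mul1g mulg1.
- case/prods_rec => k [w' [/IH[k' [w1 [H1 ->]]] ->]].
  exists k', (w1 * gen n k)%g; rewrite mulgA; split=> //.
  by apply/prods_rec; exists k, w1.
- case=> k [w' [/prods_rec[k' [w1 [H1 ->]]] ->]]; apply/prods_rec.
  exists k', (gen n k * w1)%g; rewrite mulgA; split=> //.
  by apply/IH; exists k, w1.
Qed.

Lemma prods_Bn m w : w \in prods n m -> w \in Bn n.
Proof.
elim: m w => [|m IH] w; first by rewrite inE => /eqP ->; exact: Bn1.
by case/prods_rec => k [w' [/IH H ->]]; apply: BnM => //; exact: gen_Bn.
Qed.

Lemma inv_lt w a c : inv w a c -> ptval a < ptval c.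
Proof. by case/andP. Qed.

Lemma inv_pos w a c : ptval a < ptval c ->
  inv w a c = (ptval (w^-1%g c) < ptval (w^-1%g a)).
Proof. by rewrite /inv => ->. Qed.

Lemma ninv_pos w a c : ptval a < ptval c -> ~~ inv w a c ->
  ptval (w^-1%g a) < ptval (w^-1%g c).
Proof.
move=> ac; rewrite inv_pos // -leNgt le_eqVlt => /orP[/eqP/ptval_inj/perm_inj E|//].
by rewrite E ltxx in ac.
Qed.

(** * Biclosed sets of pairs and the elements that realize them *)

Record biclosed (J : rel (pt n)) : Prop := Biclosed {
  bicl_lt : forall a c, J a c -> ptval a < ptval c;
  bicl_tr : forall a b c, J a b -> J b c -> J a c;
  bicl_co : forall a b c, ptval a < ptval b -> ptval b < ptval c -> J a c -> J a b || J b c;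
  bicl_neg : forall a c, J a c -> J (negpt c) (negpt a)
}.

Lemma inv_biclosed w : w \in Bn n -> biclosed (inv w).
Proof.
move=> wB; split.
- exact: inv_lt.
- by move=> a b c; rewrite /inv; lia.
- move=> a b c ab bc H; rewrite !inv_pos //; move: H; rewrite inv_pos ?(lt_trans ab) //; lia.
- by move=> a c; rewrite /inv !pos_neg // !ptval_neg; lia.
Qed.

(** Consecutive nonzero integers are -1, 1 or two successive integers of the same sign; the negative
    ones are the mirror image of some [lo k], [hi k]. *)
Lemma adjacent_lohi p q : ptval p < ptval q ->
  (forall r, ~ (ptval p < ptval r < ptval q)) ->
  exists k, (lo k = p /\ hi k = q) \/ (negpt (hi k) = p /\ negpt (lo k) = q).
Proof.
move=> pq H; have p0 := @ptval_neq0 _ p; have q0 := @ptval_neq0 _ q.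
have pb := ptval_bound p; have qb := ptval_bound q.
have next (m : int) : ptval p < m -> m < ptval q -> m = 0.
  move=> pm mq; apply/eqP; apply: contraT => /eqP m0.
  by case: (@ptval_onto n m m0) => [|r Hr]; [lia | case: (H r); rewrite Hr; lia].
have pq' : ptval q = ptval p + 1 \/ (ptval p = -1 /\ ptval q = 1).
  have := next (ptval p + 1); have := next (ptval q - 1); lia.
case: pq' => [E|[E1 E2]].
  have [p_gt|p_lt] : 0 < ptval p \/ ptval p < 0 by lia.
    have Hk : (`|ptval p| < n)%N by lia.
    exists (Ordinal Hk); left; split; apply: ptval_inj; rewrite ?ptval_lo ?ptval_hi /=; last lia.
    by case: eqP; lia.
  have Hk : (`|ptval q| < n)%N by lia.
  exists (Ordinal Hk); right; split; apply: ptval_inj;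
    rewrite ptval_neg ?ptval_lo ?ptval_hi /=; first lia.
  by case: eqP; lia.
have Hk : (0 < n)%N by lia.
by exists (Ordinal Hk); left; split; apply: ptval_inj; rewrite ?ptval_lo ?ptval_hi //=.
Qed.

Lemma orbpN a c e f : orbp (negpt c) (negpt a) e f = orbp a c e f.
Proof. by rewrite /orbp !negptK orbC. Qed.

Definition adj w a c := forall r, ~ (ptval (w^-1%g a) < ptval (w^-1%g r) < ptval (w^-1%g c)).

Lemma adj_add w a c : w \in Bn n -> ptval a < ptval c ->
  ptval (w^-1%g a) < ptval (w^-1%g c) -> adj w a c ->
  exists k, forall e f, inv (gen n k * w)%g e f = inv w e f || orbp a c e f.
Proof.
move=> wB ac pac H; have /BnP wN := wB.
case: (adjacent_lohi pac) => [r|k].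
  by have := H (w r); rewrite permK.
case=> [[E1 E2]|[E1 E2]]; exists k => e f; rewrite inv_gen // ?E1 ?E2 ?permKV //.
  rewrite -(negptK (hi k)) -(negptK (lo k)) E1 E2 !wN !permKV.
  by rewrite orbpN.
by rewrite -(negptK (hi k)) -(negptK (lo k)) E1 E2 !wN !permKV !ptval_neg ltrN2.
Qed.

Lemma adj_del w a c : w \in Bn n -> inv w a c -> adj w c a ->
  exists2 w', w' \in Bn n & ~~ inv w' a c /\ forall e f, inv w e f = inv w' e f || orbp a c e f.
Proof.
move=> wB iac H; have /BnP wN := wB; have /andP[ac pac] := iac.
case: (adjacent_lohi pac) => [r|k].
  by have := H (w r); rewrite permK.
have w'B : (gen n k * w)%g \in Bn n by rewrite BnM // gen_Bn.
have E : w = (gen n k * (gen n k * w))%g by rewrite mulgA genM mul1g.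
have [[gl gh _ _ _] /BnP gN] := (gen_swaps k, gen_Bn k).
move=> Hk; exists (gen n k * w)%g => //.
have E1 : ((gen n k * w)%g (lo k) = a /\ (gen n k * w)%g (hi k) = c) \/
          ((gen n k * w)%g (lo k) = negpt c /\ (gen n k * w)%g (hi k) = negpt a).
  rewrite !permM gl gh; case: Hk => [[-> ->]|[E1 E2]]; first by left; rewrite !permKV.
  right; rewrite -(negptK (hi k)) -(negptK (lo k)) E1 E2 !wN !permKV //.
have lt : ptval ((gen n k * w)%g (lo k)) < ptval ((gen n k * w)%g (hi k)).
  by case: E1 => -[-> ->] //; rewrite !ptval_neg ltrN2.
split; last first.
  move=> e f; rewrite {1}E inv_gen //; case: E1 => -[-> ->] //; by rewrite orbpN.
rewrite /inv !pos_gen ac /= -leNgt; case: Hk => -[<- <-].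
  by rewrite gl gh ltW // ptval_lt_lohi.
by rewrite !gN gl gh !ptval_neg lerN2 ltW // ptval_lt_lohi.
Qed.

Lemma inv1 a c : inv (1%g : {perm pt n}) a c = false.
Proof. by rewrite /inv invg1 !perm1; lia. Qed.

(** Starting from the identity, one repeatedly exchanges a pair of [J] that is not yet inverted and
    whose places are closest; such a pair is adjacent, so the exchange is a multiplication by a
    generator that stays inside [J]. Applied to [inv w], this also shows that the generators
    generate $B_n$. *)
Lemma realize (J : rel (pt n)) : biclosed J ->
  exists2 w, exists m, w \in prods n m & inv w =2 J.
Proof.
move=> JB.
pose D w := [set p : pt n * pt n | J p.1 p.2 && ~~ inv w p.1 p.2].
suff H N w m : (#|D w| <= N)%N -> w \in prods n m -> (forall a c, inv w a c -> J a c) ->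
    exists2 w, exists m, w \in prods n m & inv w =2 J.
  by apply: (H _ 1%g 0%N (leqnn _)) => [|a c]; [exact: set11 | rewrite inv1].
elim: N w m => [|N IH] w m DN wm wJ; have wB := prods_Bn wm.
  exists w; first by exists m.
  move=> a c; apply/idP/idP => [/wJ//|Jac]; apply: contraT => niac.
  move: DN; rewrite leqn0 cards_eq0 => /eqP/setP/(_ (a, c)).
  by rewrite !inE /= Jac niac.
case: (set_0Vmem (D w)) => [D0|[[a0 c0] ac0]].
  exists w; first by exists m.
  move=> a c; apply/idP/idP => [/wJ//|Jac]; apply: contraT => niac.
  by move/setP/(_ (a, c)): D0; rewrite !inE /= Jac niac.
pose d (p : pt n * pt n) := absz (ptval (w^-1%g p.2) - ptval (w^-1%g p.1)).
have [[a c] acD Hmin] := arg_minnP d ac0.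
have : (a, c) \in D w by []; rewrite inE /= => /andP[Jac niac].
have ac := bicl_lt JB Jac; have pac := ninv_pos ac niac.
have min e f : J e f -> ptval (w^-1%g e) < ptval (w^-1%g f) ->
    (d (a, c) <= d (e, f))%N.
  by move=> Jef pef; apply: Hmin; change ((e, f) \in D w); rewrite inE /= Jef inv_pos ?(bicl_lt JB Jef) //; lia.
(* A value r placed between a and c would give a closer missing pair of [J]: by transitivity if r is
   below a or above c, by co-transitivity if it lies between them. *)
have Hadj : adj w a c.
  move=> r /andP[ar rc].
  have W e f : ptval e < ptval f -> ptval (w^-1%g f) < ptval (w^-1%g e) -> J e f.
    by move=> ef pf; apply: wJ; rewrite inv_pos.
  have := min r c; have := min a r; rewrite /d /= => M1 M2.
  case: (ltgtP (ptval r) (ptval a)) => [ra|ra|/ptval_inj E]; last by move: ar; rewrite E ltxx.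
    by have := M2 (bicl_tr JB (W _ _ ra ar) Jac) rc; clear -ar rc; lia.
  case: (ltgtP (ptval r) (ptval c)) => [rc'|rc'|/ptval_inj E]; last by move: rc; rewrite E ltxx.
    by case/orP: (bicl_co JB ra rc' Jac) => [/M1|/M2] H; have {H} := H ltac:(done); clear -ar rc; lia.
  by have := M1 (bicl_tr JB Jac (W _ _ rc' rc)) ar; clear -ar rc; lia.
have [k Hk] := adj_add wB ac pac Hadj.
apply: (IH (gen n k * w)%g m.+1).
- rewrite -ltnS; apply: leq_trans DN; apply: proper_card; apply/properP; split.
    by apply/subsetP => p; rewrite !inE Hk negb_or => /andP[-> /andP[-> _]].
  by exists (a, c); rewrite !inE /= ?Hk Jac ?niac //= orbp_refl orbT.
- by apply/prods_recl; exists k, w.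
- move=> e f; rewrite Hk => /orP[/wJ//|/orP[/andP[/eqP-> /eqP->]//|/andP[/eqP-> /eqP->]]].
  exact: bicl_neg.
Qed.

(* Two elements with the same inversions differ by an order-preserving
   permutation of the positions. *)
Lemma inv_inj w x : w \in Bn n -> x \in Bn n -> inv w =2 inv x -> w = x.
Proof.
move=> wB xB H.
have mono a c : ptval (w^-1%g a) < ptval (w^-1%g c) -> ptval (x^-1%g a) < ptval (x^-1%g c).
  move=> lt; have := H a c; have := H c a; rewrite /inv.
  case: (ltgtP (ptval a) (ptval c)) => [ac|ac|/ptval_inj E]; last by rewrite E ltxx in lt.
    by move=> _ /=; have := @ninv_pos x a c ac; rewrite inv_pos //; lia.
  by move=> /= <- _.
pose g := (w * x^-1)%g.
have gE p : g p = x^-1%g (w p) by rewrite permM.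
have gmono p q : ptval p < ptval q -> ptval (g p) < ptval (g q).
  by move=> pq; rewrite !gE; apply: mono; rewrite !permK.
(* An increasing map of the finite chain of places to itself lies above the identity, by induction
   on the distance to -n; applied to [negpt p] this gives the other bound. *)
have gle N p : (absz (ptval p + n%:Z)%R <= N)%N -> ptval p <= ptval (g p).
  elim: N p => [|N IH] p HN; first by have := ptval_bound p; have := ptval_bound (g p); lia.
  rewrite leNgt; apply/negP => lt.
  have pb := ptval_bound p; have gb := ptval_bound (g p).
  have := gmono _ _ lt; have := IH (g p); lia.
have glt p : ptval (g p) = ptval p.
  have gB : g \in Bn n by rewrite BnM // BnV.
  have := gle _ p (leqnn _); have := gle _ (negpt p) (leqnn _).
  by have /BnP -> := gB; rewrite !ptval_neg; lia.
apply/permP => p; have /ptval_inj := glt p; rewrite gE => E.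
by apply: (@perm_inj _ x^-1%g); rewrite permK.
Qed.

Lemma Bn_prods w : w \in Bn n -> exists m, w \in prods n m.
Proof.
move=> wB; have [w' [m w'm] E] := realize (inv_biclosed wB).
by rewrite (inv_inj wB (prods_Bn w'm)); [exists m | move=> a c; rewrite E].
Qed.

(** * Length, exchange, and the weak order as inclusion of inversions *)

Lemma has_len_ex w : w \in Bn n -> exists m, has_len w m.
Proof.
move=> /Bn_prods H; case: (ex_minnP H) => m wm Hm; exists m; split=> // j jm.
by apply: contraTN jm => /Hm; rewrite -leqNgt.
Qed.

Lemma has_len_uniq w m m' : has_len w m -> has_len w m' -> m = m'.
Proof.
move=> [H1 H2] [H3 H4]; case: (ltngtP m m') => // H.
  by have := H4 _ H; rewrite H1.
by have := H2 _ H; rewrite H3.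
Qed.

Definition refl_of x k : {perm pt n} := (x^-1 * gen n k * x)%g.

Lemma refl_ofK x k : (refl_of x k * refl_of x k = 1)%g.
Proof. by rewrite /refl_of !mulgA mulgK -(mulgA _ _ (gen n k)) genM mulg1 mulVg. Qed.

Lemma swaps_refl_of x k : x \in Bn n -> swaps (refl_of x k) (x (lo k)) (x (hi k)).
Proof. by move=> xB; apply: swaps_conj => //; exact: gen_swaps. Qed.

Lemma swaps_orb t a c e f : orbp a c e f -> swaps t a c -> swaps t e f.
Proof. by move=> /orP[] /andP[/eqP-> /eqP->] // /swapsC/swapsN. Qed.

(** Some letter of the word creates the inversion (a, c). If it multiplies $w'$, then [t] is the
    conjugate of that letter by $w'$, so multiplying by [t] deletes it. *)
Lemma strong_exchange m w t a c : w \in prods n m -> inv w a c -> swaps t a c ->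
  exists2 j, (j < m)%N & (w * t)%g \in prods n j.
Proof.
move=> + + tS; elim: m w => [|m IH] w; first by rewrite inE => /eqP ->; rewrite inv1.
case/prods_recl => k [w' [w'm ->]] iac; have w'B := prods_Bn w'm.
case: (boolP (inv w' a c)) => [/(IH _ w'm)[j jm tj]|niac].
  by exists j.+1 => //; apply/prods_recl; exists k, (w' * t)%g; rewrite mulgA.
exists m => //; suff -> : t = refl_of w' k.
  by rewrite /refl_of !mulgA -(mulgA _ _ w'^-1%g) mulgV mulg1 genM mul1g.
apply: swaps_inj tS _.
have := swaps_refl_of k w'B.
case: (ltgtP (ptval (w' (lo k))) (ptval (w' (hi k)))) => lt.
- by move: iac; rewrite inv_gen // (negPf niac) /=; exact: swaps_orb.
- have E : w' = (gen n k * (gen n k * w'))%g by rewrite mulgA genM mul1g.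
  have [gl gh _ _ _] := gen_swaps k.
  move: niac; rewrite {1}E inv_gen ?iac // ?BnM ?gen_Bn //.
  by rewrite !permM gl gh.
- move/ptval_inj/perm_inj/(congr1 (@ptval n)): lt => lt.
  by have := ptval_lt_lohi k; rewrite lt ltxx.
Qed.

Lemma exchange_len w t a c : w \in Bn n -> inv w a c -> swaps t a c -> len_lt (w * t)%g w.
Proof.
move=> /has_len_ex[m wm] iac tS.
have [j jm tj] := strong_exchange wm.1 iac tS.
have [i ti] := has_len_ex (prods_Bn tj).
exists i, m; split=> //; apply: leq_ltn_trans jm.
by rewrite leqNgt; apply/negP => /(ti.2); rewrite tj.
Qed.

(** If (a, c) is not inverted in [w], it is inverted in the product of [w] with the reflection;
    multiplying back shortens that product, so the length cannot have dropped the first time. *)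
Lemma len_ltP w x k a c : w \in Bn n -> x \in Bn n -> ptval a < ptval c ->
  swaps (refl_of x k) a c -> len_lt (w * refl_of x k)%g w <-> inv w a c.
Proof.
move=> wB xB ac tS; split=> [|iac]; last exact: exchange_len tS.
case: (boolP (inv w a c)) => // niac [i [m [ti wm im]]].
have tB : refl_of x k \in Bn n by rewrite !BnM ?BnV ?gen_Bn.
have iac : inv (w * refl_of x k)%g a c.
  have [ta tc _ _ _] := tS.
  have tV : (refl_of x k)^-1%g = refl_of x k by apply/eqP; rewrite eq_invg_mul refl_ofK.
  by rewrite /inv ac invMg tV !(permM (refl_of x k)) ta tc /= ninv_pos.
have := exchange_len (BnM wB tB) iac tS; rewrite -mulgA refl_ofK mulg1.
case=> [i' [m' [wi' tm' lt]]].
have := has_len_uniq ti tm'; have := has_len_uniq wm wi'; lia.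
Qed.

Lemma swaps_sorted x k : x \in Bn n -> exists a c, ptval a < ptval c /\ swaps (refl_of x k) a c.
Proof.
move=> xB; have S := swaps_refl_of k xB.
case: (ltgtP (ptval (x (lo k))) (ptval (x (hi k)))) => lt.
- by exists (x (lo k)), (x (hi k)).
- by exists (x (hi k)), (x (lo k)); split=> //; exact: swapsC.
- move/ptval_inj/perm_inj/(congr1 (@ptval n)): lt => lt.
  by have := ptval_lt_lohi k; rewrite lt ltxx.
Qed.

(** The letter creating the inversion supplies the reflection. This is needed because [wle]
    quantifies over reflections and not over pairs. *)
Lemma inv_refl_of w a c : w \in Bn n -> inv w a c ->
  exists2 x, x \in Bn n & exists k, swaps (refl_of x k) a c.
Proof.
move=> /Bn_prods[m]; elim: m w => [|m IH] w; first by rewrite inE => /eqP ->; rewrite inv1.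
case/prods_recl => k [w' [w'm ->]] iac; have w'B := prods_Bn w'm.
case: (boolP (inv w' a c)) => [/(IH _ w'm)//|niac].
exists w' => //; exists k.
have := swaps_refl_of k w'B.
case: (ltgtP (ptval (w' (lo k))) (ptval (w' (hi k)))) => lt.
- by move: iac; rewrite inv_gen // (negPf niac) /=; exact: swaps_orb.
- have E : w' = (gen n k * (gen n k * w'))%g by rewrite mulgA genM mul1g.
  have [gl gh _ _ _] := gen_swaps k.
  move: niac; rewrite {1}E inv_gen ?iac // ?BnM ?gen_Bn //.
  by rewrite !permM gl gh.
- move/ptval_inj/perm_inj/(congr1 (@ptval n)): lt => lt.
  by have := ptval_lt_lohi k; rewrite lt ltxx.
Qed.

Lemma wleP v w : v \in Bn n -> w \in Bn n ->
  wle v w <-> (forall a c, inv v a c -> inv w a c).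
Proof.
move=> vB wB; split=> [vw a c iac|H t [tr tl]].
  have [x xB [k tS]] := inv_refl_of vB iac; have ac := inv_lt iac.
  have [] := vw (refl_of x k); last by move=> _ /(len_ltP wB xB ac tS).
  split; last exact/(len_ltP vB xB ac tS).
  by exists x, (gen n k); split=> //; apply/mem_gens; exists k.
split=> //; case: tr tl => x [s [xB /mem_gens[k ->] ->]].
have [a [c [ac tS]]] := swaps_sorted k xB.
by move=> /(len_ltP vB xB ac tS)/H/(len_ltP wB xB ac tS).
Qed.

End Words.

(** * Joins, meets, congruences and duality *)

Section Lattice.
Variable n : nat.
Implicit Types (a b c e f p q r : pt n) (w x y z s t u : {perm pt n}) (k : 'I_n).

Definition ile x y := forall a c, inv x a c -> inv y a c.

Lemma ile_refl x : ile x x.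
Proof. by []. Qed.

Lemma ile_anti x y : x \in Bn n -> y \in Bn n -> ile x y -> ile y x -> x = y.
Proof. by move=> xB yB xy yx; apply: inv_inj => // a c; apply/idP/idP => [/xy|/yx]. Qed.

Definition jspec x y z := [/\ z \in Bn n, ile x z, ile y z &
  forall u, u \in Bn n -> ile x u -> ile y u -> ile z u].
Definition mspec x y z := [/\ z \in Bn n, ile z x, ile z y &
  forall u, u \in Bn n -> ile u x -> ile u y -> ile u z].

Lemma is_joinP x y z : x \in Bn n -> y \in Bn n -> is_join x y z <-> jspec x y z.
Proof.
move=> xB yB; split=> -[zB]; rewrite ?wleP // => xz yz H; split; rewrite ?wleP // => u uB.
  by move=> /(wleP xB uB) xu /(wleP yB uB) yu; apply/(wleP zB uB)/H.
by rewrite !wleP //; exact: H.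
Qed.

Lemma is_meetP x y z : x \in Bn n -> y \in Bn n -> is_meet x y z <-> mspec x y z.
Proof.
move=> xB yB; split=> -[zB]; rewrite ?wleP // => xz yz H; split; rewrite ?wleP // => u uB.
  by move=> /(wleP uB xB) xu /(wleP uB yB) yu; apply/(wleP uB zB)/H.
by rewrite !wleP //; exact: H.
Qed.

(** * Joins as transitive closures of unions *)

Definition trans_rel (N : rel (pt n)) := forall a b c, N a b -> N b c -> N a c.

Definition trans_set (N : {set pt n * pt n}) :=
  [forall a, forall b, forall c, ((a, b) \in N) ==> ((b, c) \in N) ==> ((a, c) \in N)].

(** Transitive closure as the intersection of all transitive supersets, which keeps it boolean and
    makes [tclosure_min] its induction principle. *)
Definition tclosure (U : rel (pt n)) a c :=
  [forall N : {set pt n * pt n},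
    trans_set N && [forall p, U p.1 p.2 ==> (p \in N)] ==> ((a, c) \in N)].

Lemma trans_setP N : trans_set N -> forall a b c, (a, b) \in N -> (b, c) \in N -> (a, c) \in N.
Proof.
by move=> /forallP H a b c ab bc; have /forallP/(_ b)/forallP/(_ c) := H a; rewrite ab bc.
Qed.

Lemma tclosure_min (U N : rel (pt n)) : trans_rel N -> (forall a c, U a c -> N a c) ->
  forall a c, tclosure U a c -> N a c.
Proof.
move=> tN UN a c /forallP/(_ [set p | N p.1 p.2]); rewrite inE /= => /implyP; apply.
apply/andP; split; last by apply/forallP => -[e f]; rewrite inE; apply/implyP/UN.
apply/forallP => e; apply/forallP => f; apply/forallP => g.
by rewrite !inE /=; apply/implyP => ef; apply/implyP; exact: tN ef.
Qed.

Lemma tclosure_sub (U : rel (pt n)) a c : U a c -> tclosure U a c.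
Proof.
by move=> Uac; apply/forallP => N; apply/implyP => /andP[_ /forallP/(_ (a, c))/implyP]; apply.
Qed.

Lemma tclosure_tr (U : rel (pt n)) : trans_rel (tclosure U).
Proof.
move=> a b c /forallP ab /forallP bc; apply/forallP => N; apply/implyP => H.
have /andP[/trans_setP tN _] := H.
by apply: (tN _ b); [have /implyP := ab N | have /implyP := bc N]; exact.
Qed.

Lemma tclosure_biclosed x y : x \in Bn n -> y \in Bn n ->
  biclosed (tclosure (fun a c => inv x a c || inv y a c)).
Proof.
move=> xB yB; set U := fun a c => _.
have sub : forall a c, tclosure U a c -> ptval a < ptval c.
  apply: tclosure_min => [a b c|a c /orP[]]; [exact: lt_trans | exact: inv_lt..].
split=> //; first exact: tclosure_tr; last first.
  apply: tclosure_min => [a b c ba cb|a c]; first exact: tclosure_tr cb ba.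
  by case/orP => /(bicl_neg (inv_biclosed _)) H; apply: tclosure_sub; rewrite /U H ?orbT.
(* The pairs that every intermediate value splits form a transitive relation. *)
pose N a c := tclosure U a c && [forall b, (ptval a < ptval b) && (ptval b < ptval c) ==>
   (tclosure U a b || tclosure U b c)].
have H a c : tclosure U a c -> N a c.
  apply: tclosure_min => {a c} [a b c /andP[ab /forallP abN] /andP[bc /forallP bcN]|a c Uac].
    apply/andP; split; first exact: tclosure_tr ab bc.
    apply/forallP => d; apply/implyP => /andP[ad dc].
    case: (ltgtP (ptval d) (ptval b)) => [db|bd|/ptval_inj ->]; last by rewrite ab.
      have := abN d; rewrite ad db /= => /orP[->//|db']; apply/orP; right; exact: tclosure_tr db' bc.
    have := bcN d; rewrite bd dc /= => /orP[bd'|->]; last by rewrite orbT.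
    by apply/orP; left; exact: tclosure_tr ab bd'.
  apply/andP; split; first exact: tclosure_sub.
  apply/forallP => d; apply/implyP => /andP[ad dc].
  case/orP: Uac => Uac.
    by case/orP: (bicl_co (inv_biclosed xB) ad dc Uac) => H; apply/orP; [left|right];
      apply: tclosure_sub; rewrite /U H.
  by case/orP: (bicl_co (inv_biclosed yB) ad dc Uac) => H; apply/orP; [left|right];
    apply: tclosure_sub; rewrite /U H orbT.
move=> a b c ab bc /H/andP[_ /forallP/(_ b)]; by rewrite ab bc.
Qed.

(** The closure of the union is biclosed, hence realized by an element. The second clause is the
    induction principle on inversions of a join that later arguments use through [jspec_min]. *)
Lemma join_ex x y : x \in Bn n -> y \in Bn n -> exists2 z, jspec x y z &
  forall N, trans_rel N -> (forall a c, inv x a c || inv y a c -> N a c) ->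
    forall a c, inv z a c -> N a c.
Proof.
move=> xB yB; have [z [m zm] E] := realize (tclosure_biclosed xB yB).
have H N : trans_rel N -> (forall a c, inv x a c || inv y a c -> N a c) ->
    forall a c, inv z a c -> N a c by move=> tN UN a c; rewrite E; exact: tclosure_min.
exists z => //; split.
- exact: prods_Bn zm.
- by move=> a c xac; rewrite E tclosure_sub ?xac.
- by move=> a c yac; rewrite E tclosure_sub ?yac ?orbT.
- move=> u uB xu yu; apply: H => [|a c /orP[/xu|/yu]//].
  exact: bicl_tr (inv_biclosed uB).
Qed.

Lemma jspec_min x y z (N : rel (pt n)) : x \in Bn n -> y \in Bn n -> jspec x y z ->
  trans_rel N -> (forall a c, inv x a c -> N a c) -> (forall a c, inv y a c -> N a c) ->
  forall a c, inv z a c -> N a c.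
Proof.
move=> xB yB [_ _ _ Hz] tN xN yN a c; have [z' [z'B xz' yz' _] Hz'] := join_ex xB yB.
by move=> /(Hz _ z'B xz' yz'); apply: Hz' => // e f /orP[/xN|/yN].
Qed.

Lemma jspec_uniq x y z z' : jspec x y z -> jspec x y z' -> z = z'.
Proof. by case=> zB xz yz H [zB' xz' yz' H']; apply: ile_anti; auto. Qed.

(** * Duality: negating all values complements inversion sets and exchanges joins with meets *)

Definition dual w : {perm pt n} := (w * perm (can_inj (@negptK n)))%g.

Lemma dualE w a : dual w a = negpt (w a).
Proof. by rewrite permM permE. Qed.

Lemma dual_Bn w : w \in Bn n -> dual w \in Bn n.
Proof. by move=> wB; apply/BnP => a; rewrite !dualE; have /BnP -> := wB. Qed.

Lemma dualK w : dual (dual w) = w.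
Proof. by apply/permP => a; rewrite !dualE negptK. Qed.

Lemma dual_pos w a : w \in Bn n -> ptval ((dual w)^-1%g a) = - ptval (w^-1%g a).
Proof.
move=> wB; rewrite -pos_neg //; congr ptval; apply: (@perm_inj _ (dual w)).
by rewrite permKV dualE permKV negptK.
Qed.

Lemma inv_dual w a c : w \in Bn n -> inv (dual w) a c = (ptval a < ptval c) && ~~ inv w a c.
Proof.
move=> wB; rewrite /inv !dual_pos //; case: ltP => //= ac.
case: (ltgtP (ptval (w^-1%g a)) (ptval (w^-1%g c))) => [||/ptval_inj/perm_inj E].
- by lia.
- by lia.
- by rewrite E ltxx in ac.
Qed.

Lemma ile_dual x y : x \in Bn n -> y \in Bn n -> ile (dual x) (dual y) <-> ile y x.
Proof.
move=> xB yB; split=> H a c.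
  move=> ya; have := H a c; rewrite !inv_dual // ya (inv_lt ya) /=.
  by case: (inv x a c) => // /(_ isT).
by rewrite !inv_dual // => /andP[-> /=]; apply: contra; exact: H.
Qed.

Lemma jspec_dual x y z : x \in Bn n -> y \in Bn n ->
  jspec (dual x) (dual y) (dual z) <-> mspec x y z.
Proof.
move=> xB yB; have dB u : (dual u \in Bn n) = (u \in Bn n).
  by apply/idP/idP => /dual_Bn //; rewrite dualK.
split=> -[zB xz yz H]; (split; rewrite ?dB // in zB *; try exact/ile_dual) => u uB.
  by move=> ux uy; apply/ile_dual/H; rewrite ?dB //; exact/ile_dual.
rewrite -(dualK u) in uB *; rewrite dB in uB; rewrite !ile_dual //; exact: H.
Qed.

Lemma meet_ex x y : x \in Bn n -> y \in Bn n -> exists z, mspec x y z.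
Proof.
move=> xB yB; have [z Hz _] := join_ex (dual_Bn xB) (dual_Bn yB).
by exists (dual z); apply/jspec_dual => //; rewrite dualK.
Qed.

(** Dual form of [jspec_min]: the non-inversions of a meet arise by chaining non-inversions of its
    two arguments. *)
Lemma mspec_min x y z (N : rel (pt n)) : x \in Bn n -> y \in Bn n -> mspec x y z ->
  trans_rel N ->
  (forall a c, ptval a < ptval c -> ~~ inv x a c -> N a c) ->
  (forall a c, ptval a < ptval c -> ~~ inv y a c -> N a c) ->
  forall a c, ptval a < ptval c -> ~~ inv z a c -> N a c.
Proof.
move=> xB yB Hz tN xN yN a c ac nz; have [zB _ _ _] := Hz; move/jspec_dual: Hz => Hz.
apply: (jspec_min (dual_Bn xB) (dual_Bn yB) (Hz xB yB) tN).
- by move=> e f; rewrite inv_dual // => /andP[]; exact: xN.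
- by move=> e f; rewrite inv_dual // => /andP[]; exact: yN.
- by rewrite inv_dual // ac nz.
Qed.

(** * Lattice congruences in terms of inversion sets *)

Record cong (R : {perm pt n} -> {perm pt n} -> Prop) : Prop := Cong {
  cong_Bn : forall x y, R x y -> x \in Bn n /\ y \in Bn n;
  cong_refl : forall x, x \in Bn n -> R x x;
  cong_sym : forall x y, R x y -> R y x;
  cong_trans : forall y x z, R x y -> R y z -> R x z;
  cong_join : forall x y z j j', z \in Bn n -> R x y -> jspec x z j -> jspec y z j' -> R j j';
  cong_meet : forall x y z m m', z \in Bn n -> R x y -> mspec x z m -> mspec y z m' -> R m m'
}.

Lemma lat_congP R : is_lat_cong R <-> cong R.
Proof.
split=> [[HB Hr Hs Ht [Hj Hm]]|[HB Hr Hs Ht Hj Hm]]; split=> //.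
- by move=> y x z; exact: Ht.
- move=> x y z j j' zB xy; have [xB yB] := HB _ _ xy.
  by move=> /(is_joinP _ xB zB) J /(is_joinP _ yB zB) J'; exact: Hj xy J J'.
- move=> x y z j j' zB xy; have [xB yB] := HB _ _ xy.
  by move=> /(is_meetP _ xB zB) J /(is_meetP _ yB zB) J'; exact: Hm xy J J'.
- by move=> x y z; exact: Ht.
- split=> x y z j j' zB xy; have [xB yB] := HB _ _ xy; rewrite ?is_joinP ?is_meetP //.
    exact: Hj xy.
  exact: Hm xy.
Qed.

Lemma cong_dual R : cong R -> cong (fun x y => R (dual x) (dual y)).
Proof.
have dB u : (dual u \in Bn n) = (u \in Bn n).
  by apply/idP/idP => /dual_Bn //; rewrite dualK.
case=> HB Hr Hs Ht Hj Hm; split=> /=.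
- by move=> x y /HB; rewrite !dB.
- by move=> x xB; apply: Hr; rewrite dB.
- by move=> x y; exact: Hs.
- by move=> y x z; exact: Ht.
- move=> x y z j j' zB xy; have [] := HB _ _ xy; rewrite !dB => xB yB J J'.
  apply: (Hm _ _ (dual z) _ _ _ xy); rewrite ?dB //.
    by apply/jspec_dual; rewrite ?dB ?dualK.
  by apply/jspec_dual; rewrite ?dB ?dualK.
- move=> x y z j j' zB xy; have [] := HB _ _ xy; rewrite !dB => xB yB J J'.
  by apply: (Hj _ _ (dual z) _ _ _ xy); rewrite ?dB //; apply/jspec_dual.
Qed.

Lemma jspec_le x y : y \in Bn n -> ile x y -> jspec x y y.
Proof. by move=> yB xy; split. Qed.

Lemma mspecC x y z : mspec x y z -> mspec y x z.
Proof. by case=> zB xz yz H; split=> // u uB yu xu; exact: H. Qed.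

Lemma mspec_le x y : x \in Bn n -> ile x y -> mspec x y x.
Proof. by move=> xB xy; split. Qed.

Lemma join_exists x y : x \in Bn n -> y \in Bn n -> exists z, jspec x y z.
Proof. by move=> xB yB; have [z Hz _] := join_ex xB yB; exists z. Qed.

End Lattice.

(** * The two classes and their congruences *)

Section PatternClasses.
Variable n : nat.
Implicit Types (a b c e f p q r : pt n) (w x y z s t u : {perm pt n}) (k : 'I_n).

Definition side (sg : bool) b := (0 < ptval b) == sg.

(* For an inversion set this says that no b with sign sg and a < b < c is
   placed in the order b c a, see sided_half. *)
Definition sided sg (J : rel (pt n)) := forall a b c, ptval a < ptval b -> ptval b < ptval c ->
  J a c -> if side sg b then J b c else J a b.

Lemma side_neg sg b : side sg (negpt b) = ~~ side sg b.
Proof. by rewrite /side ptval_neg; have := @ptval_neq0 _ b; case: sg; lia. Qed.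

(** The central symmetry sends (a, b, c) to (-c, -b, -a) and flips the sign of the middle value, so
    one branch of [sided] implies the other. *)
Lemma sided_half sg w : w \in Bn n ->
  (forall a b c, ptval a < ptval b -> ptval b < ptval c -> side sg b -> inv w a c -> inv w b c) ->
  sided sg (inv w).
Proof.
move=> wB H a b c ab bc ac; case: ifP => [sb|/negbT sb]; first exact: H ac.
have wN := bicl_neg (inv_biclosed wB).
have := H (negpt c) (negpt b) (negpt a); rewrite !ptval_neg side_neg !ltrN2.
by move=> /(_ bc ab sb (wN _ _ ac))/wN; rewrite !negptK.
Qed.

(** Co-transitivity is what an intersection of inversion sets may lose. Sidedness saves it: the sign
    of b makes the same choice between (a, b) and (b, c) in both sets. *)
Lemma sided_meet sg x y : x \in Bn n -> y \in Bn n -> sided sg (inv x) -> sided sg (inv y) ->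
  exists2 z, mspec x y z & inv z =2 (fun a c => inv x a c && inv y a c).
Proof.
move=> xB yB xs ys; pose J a c := inv x a c && inv y a c.
have JB : biclosed J.
  split.
  - by move=> a c /andP[/inv_lt].
  - move=> a b c /andP[xab yab] /andP[xbc ybc].
    by rewrite /J (bicl_tr (inv_biclosed xB) xab xbc) (bicl_tr (inv_biclosed yB) yab ybc).
  - move=> a b c ab bc /andP[/(xs _ _ _ ab bc) + /(ys _ _ _ ab bc)].
    by rewrite /J; case: ifP => _ -> ->; rewrite ?orbT.
  - by move=> a c /andP[/(bicl_neg (inv_biclosed xB)) xN /(bicl_neg (inv_biclosed yB)) yN]; rewrite /J xN.
have [z [m zm] E] := realize JB; exists z => //; split.
- exact: prods_Bn zm.
- by move=> a c; rewrite E => /andP[].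
- by move=> a c; rewrite E => /andP[].
- by move=> u uB ux uy a c uac; rewrite E /J ux ?uy.
Qed.

(** The inversions of [z] that satisfy the side condition form a transitive relation: a value
    between a and c lies inside one of the two steps of the chain a, b, c, or equals b, and that
    step decides it. *)
Lemma sided_join sg x y z : x \in Bn n -> y \in Bn n -> sided sg (inv x) -> sided sg (inv y) ->
  jspec x y z -> sided sg (inv z).
Proof.
move=> xB yB xs ys Hz; have [zB xz yz _] := Hz.
have ztr := bicl_tr (inv_biclosed zB).
pose N a c := inv z a c && [forall b, (ptval a < ptval b) && (ptval b < ptval c) ==>
   if side sg b then inv z b c else inv z a b].
have NI w a c : ile w z -> sided sg (inv w) -> inv w a c -> N a c.
  move=> wz ws wac; rewrite /N wz //=; apply/forallP => b; apply/implyP => /andP[ab bc].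
  by have := ws _ _ _ ab bc wac; case: ifP => _ /wz.
suff H a c : inv z a c -> N a c.
  by move=> a b c ab bc /H /andP[_ /forallP/(_ b)]; rewrite ab bc.
apply: (jspec_min xB yB Hz) => {a c} [a b c /andP[ab /forallP abN] /andP[bc /forallP bcN]| |].
- rewrite /N (ztr _ _ _ ab bc) /=; apply/forallP => d; apply/implyP => /andP[ad dc].
  case: (ltgtP (ptval d) (ptval b)) => [db|bd|/ptval_inj ->]; last by rewrite ab bc if_same.
    by have := abN d; rewrite ad db /=; case: ifP => // _ db'; exact: ztr db' bc.
  by have := bcN d; rewrite bd dc /=; case: ifP => // _ bd'; exact: ztr ab bd'.
- by move=> a c; exact: NI.
- by move=> a c; exact: NI.
Qed.

Lemma sided_sublattice sg (L : {set {perm pt n}}) :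
  (forall w, w \in L <-> w \in Bn n /\ sided sg (inv w)) -> sublattice L.
Proof.
move=> LP; split; first by apply/subsetP => w /LP[].
move=> x y /LP[xB xs] /LP[yB ys]; split.
  have [z Hz] := join_exists xB yB; have [zB _ _ _] := Hz; exists z; last exact/is_joinP.
  by apply/LP; split=> //; apply: sided_join Hz.
have [z Hz E] := sided_meet xB yB xs ys; have [zB _ _ _] := Hz; exists z; last exact/is_meetP.
apply/LP; split=> // a b c ab bc; rewrite !E => /andP[/(xs _ _ _ ab bc) + /(ys _ _ _ ab bc)].
by case: ifP => _ -> ->.
Qed.

(* The inversions of the largest sided element below w. *)
Definition interior w a c := inv w a c &&
  [forall b, (ptval a < ptval b < ptval c) ==> if side true b then inv w b c else inv w a b].

Lemma interiorP w a c : reflect (inv w a c /\ forall b, ptval a < ptval b -> ptval b < ptval c ->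
   if side true b then inv w b c else inv w a b) (interior w a c).
Proof.
apply: (iffP andP) => -[ac H]; split=> //.
  by move=> b ab bc; have /forallP/(_ b) := H; rewrite ab bc.
by apply/forallP => b; apply/implyP => /andP[]; exact: H.
Qed.

Lemma interior_sub w a c : interior w a c -> inv w a c.
Proof. by case/andP. Qed.

(** Removing bad pairs once is enough: for b > 0 all values between b and c are positive, for b < 0
    all values between a and b are negative, so the conditions required of the smaller pair are
    among those known for (a, c). *)
Lemma interior_sided w : w \in Bn n -> sided true (interior w).
Proof.
move=> wB a b c ab bc /interiorP[ac H].
have := H b ab bc; case: ifP => sb wbc; apply/interiorP; split=> // d.
  move=> bd dc; have := H d (lt_trans ab bd) dc; case: ifP => // sd _.
  by move: sb sd; rewrite /side; lia.
move=> ad db; have := H d ad (lt_trans db bc); case: ifP => // sd _.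
by move: sb sd; rewrite /side; lia.
Qed.

Lemma interior_max w (J : rel (pt n)) : sided true J -> (forall a c, J a c -> inv w a c) ->
  forall a c, J a c -> interior w a c.
Proof.
move=> Js Jw a c Jac; apply/interiorP; split; first exact: Jw.
by move=> b ab bc; have := Js _ _ _ ab bc Jac; case: ifP => _ /Jw.
Qed.

Lemma interior_biclosed w : w \in Bn n -> biclosed (interior w).
Proof.
move=> wB; have [_ wtr _ wN] := inv_biclosed wB; split.
- by move=> a c /interior_sub/inv_lt.
- move=> a b c /interiorP[ab abH] /interiorP[bc bcH]; apply/interiorP; split.
    exact: wtr ab bc.
  move=> d ad dc; case: (ltgtP (ptval d) (ptval b)) => [db|bd|/ptval_inj ->].
  + by have := abH d ad db; case: ifP => // _ db'; exact: wtr db' bc.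
  + by have := bcH d bd dc; case: ifP => // _ bd'; exact: wtr ab bd'.
  + by rewrite ab bc if_same.
- move=> a b c ab bc /(interior_sided wB ab bc).
  by case: ifP => _ ->; rewrite ?orbT.
- move=> a c /interiorP[ac H]; apply/interiorP; split; first exact: wN.
  move=> b; rewrite !ptval_neg => cb ba.
  have := H (negpt b); rewrite ptval_neg side_neg; case: (side true b) => /=.
    by move=> /(_ ltac:(lia) ltac:(lia))/wN; rewrite negptK.
  by move=> /(_ ltac:(lia) ltac:(lia))/wN; rewrite negptK.
Qed.

Lemma interior_ile x y : ile x y -> forall a c, interior x a c -> interior y a c.
Proof.
move=> xy a c /interiorP[ac H]; apply/interiorP; split; first exact: xy.
by move=> b ab bc; have := H b ab bc; case: ifP => _ /xy.
Qed.

Lemma interior_id w : sided true (inv w) -> interior w =2 inv w.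
Proof. by move=> ws a c; apply/idP/idP => [/interior_sub//|]; exact: interior_max. Qed.

(** The interiors are realized by sided elements [u] and [v]; their meet is an intersection, lies
    below [z] and is sided, so [interior_max] applies to it. *)
Lemma interior_meet x y z : x \in Bn n -> y \in Bn n -> mspec x y z ->
  interior z =2 (fun a c => interior x a c && interior y a c).
Proof.
move=> xB yB [zB zx zy Hz] a c; apply/idP/andP => [H|[xac yac]].
  by split; apply: interior_ile H.
have [u [m um] uE] := realize (interior_biclosed xB); have uB := prods_Bn um.
have [v [m' vm] vE] := realize (interior_biclosed yB); have vB := prods_Bn vm.
have us : sided true (inv u) by move=> e f g ef fg; rewrite !uE; exact: interior_sided.
have vs : sided true (inv v) by move=> e f g ef fg; rewrite !vE; exact: interior_sided.
have [t [tB _ _ _] tE] := sided_meet uB vB us vs.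
have tz : ile t z.
  by apply: Hz => // e f; rewrite tE uE vE => /andP[/interior_sub + /interior_sub].
apply: (@interior_max z (inv t)) => //; last by rewrite tE uE vE xac.
move=> e f g ef fg; rewrite !tE => /andP[/(us _ _ _ ef fg) + /(vs _ _ _ ef fg)].
by case: ifP => _ -> ->.
Qed.

(* Among the steps (p, q) of a chain from a to c in the union of the two inversion
   sets such that p is a or negative and q is c or positive, a shortest one lies
   in the interior of one of the two sets. *)
Lemma interior_join x y z v : x \in Bn n -> y \in Bn n -> v \in Bn n -> jspec x y z ->
  (forall a c, interior x a c -> inv v a c) -> (forall a c, interior y a c -> inv v a c) ->
  forall a c, interior z a c -> inv v a c.
Proof.
move=> xB yB vB Hz xv yv; have [zB _ _ _] := Hz.
have vtr := bicl_tr (inv_biclosed vB).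
pose U a c := inv x a c || inv y a c.
pose good a c (p : pt n * pt n) :=
  [&& U p.1 p.2, ptval a <= ptval p.1, ptval p.2 <= ptval c,
      (p.1 == a) || (ptval p.1 < 0) & (p.2 == c) || (0 < ptval p.2)].
have Uz a c : inv z a c -> [exists p, good a c p].
  have Ulow w : (forall a c, inv w a c -> U a c) -> forall a c, inv w a c -> [exists p, good a c p].
    by move=> wU e f ef; apply/existsP; exists (e, f); rewrite /good /= wU // !lexx !eqxx.
  apply: (jspec_min (N := fun a c => [exists p, good a c p]) xB yB Hz) => {a c} [a b c||].
  - case/existsP => -[p q] /and5P[/= Upq ap qb ap' qb'] /existsP[[p' q'] /and5P[/= Upq' bp' q'c bp'' qc']].
    have ab : ptval a < ptval b by move: ap qb; case/orP: Upq => /inv_lt; clear; lia.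
    have bc : ptval b < ptval c by move: bp' q'c; case/orP: Upq' => /inv_lt; clear; lia.
    have q0 := @ptval_neq0 _ q; have b0 := @ptval_neq0 _ b.
    (* If q is positive, (p, q) remains good for (a, c). Otherwise q = b is negative, which makes p'
       negative and (p', q') good. *)
    case: (ltP 0 (ptval q)) => q_sg; apply/existsP.
      by exists (p, q); rewrite /good /= Upq ap ap' q_sg orbT !andbT /=; move: qb bc; clear; lia.
    have qE : q = b by case/orP: qb' => [/eqP//|]; rewrite ltNge q_sg.
    rewrite qE in q_sg.
    exists (p', q'); rewrite /good /= Upq' q'c qc' !andbT /=.
    apply/andP; split; first by move: ab bp'; clear; lia.
    by apply/orP; right; case/orP: bp'' => [/eqP ->|//]; move: q_sg b0; clear; lia.
  - by apply: Ulow => a c; rewrite /U => ->.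
  - by apply: Ulow => a c; rewrite /U => ->; rewrite orbT.
suff H N a c : (absz (ptval c - ptval a)%R <= N)%N -> interior z a c -> inv v a c.
  by move=> a c; exact: H (leqnn _).
elim: N a c => [|N IH] a c HN zac; first by have := inv_lt (interior_sub zac); lia.
have /existsP[p0 Hp0] := Uz _ _ (interior_sub zac).
pose d (p : pt n * pt n) := absz (ptval p.2 - ptval p.1).
have [[p q] good_pq Hmin] := arg_minnP d Hp0.
have {}Hmin p' q' : good a c (p', q') ->
    (absz (ptval q - ptval p)%R <= absz (ptval q' - ptval p')%R)%N by move/Hmin.
have /and5P[/= Upq ap qc ap' qc'] := good_pq.
have pq : ptval p < ptval q by case/orP: Upq => /inv_lt.
have zs := interior_sided zB.
(* If p differs from a it is negative, so sidedness puts (a, p) in the interior of [z] and induction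
   applies to this shorter pair; symmetrically for q. *)
have vap : p = a \/ inv v a p.
  case/orP: ap' => [/eqP->|p0']; first by left.
  case: (eqVneq p a) => [->|pa]; [by left | right].
  have lap : ptval a < ptval p by rewrite lt_neqAle ap andbT eq_sym -eq_ptval.
  apply: IH; first by move: HN lap pq qc; clear; lia.
  have := zs a p c lap (lt_le_trans pq qc) zac.
  by rewrite /side eqb_id ltNge (ltW p0').
have vqc : q = c \/ inv v q c.
  case/orP: qc' => [/eqP->|q0']; first by left.
  case: (eqVneq q c) => [->|qc'']; [by left | right].
  have lqc : ptval q < ptval c by rewrite lt_neqAle qc andbT -eq_ptval.
  apply: IH; first by move: HN lqc pq ap; clear; lia.
  have := zs a q c (le_lt_trans ap pq) lqc zac.
  by rewrite /side eqb_id q0'.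
(* A value b violating the interior condition would make (p, b) or (b, q), according to its sign, a
   shorter good step. *)
have intr w : w \in Bn n -> (forall a c, inv w a c -> U a c) -> inv w p q -> interior w p q.
  move=> wB wU wpq; apply/interiorP; split=> // b pb bq.
  have /orP co := bicl_co (inv_biclosed wB) pb bq wpq.
  rewrite /side eqb_id; case: ifP => b0.
    case: co => // /wU Upb; have := Hmin p b; rewrite /good /= Upb ap ap' b0 orbT /= !andbT.
    by move: pb bq qc; clear; lia.
  case: co => // /wU Ubq; have := Hmin b q; rewrite /good /= Ubq qc qc' /= !andbT.
  have -> : ptval b < 0 by move: b0 (@ptval_neq0 _ b); clear; lia.
  by rewrite orbT; move: pb bq ap; clear; lia.
have vpq : inv v p q.
  case/orP: Upq => [xpq|ypq]; [apply: xv | apply: yv]; apply: intr => // e f; rewrite /U => -> //.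
  by rewrite orbT.
case: vap => [<-|vap]; case: vqc => [<-|vqc] //; [exact: vtr vqc|exact: vtr vpq|].
exact: vtr vap (vtr _ _ _ vpq vqc).
Qed.

Definition same_interior x y := [/\ x \in Bn n, y \in Bn n & interior x =2 interior y].

(** Compatibility with joins comes from [interior_join], where only the interiors of the joined
    elements have to lie below the bound; compatibility with meets comes from [interior_meet]. *)
Lemma same_interior_cong : cong same_interior.
Proof.
split.
- by move=> x y [].
- by move=> x xB; split.
- by move=> x y [xB yB H]; split=> // a c; rewrite H.
- by move=> y x z [xB yB H] [_ zB K]; split=> // a c; rewrite H K.
- move=> x y z j j' zB [xB yB H] J J'; have [jB xj zj _] := J; have [j'B yj' zj' _] := J'.
  have half x1 y1 j1 j2 : x1 \in Bn n -> j2 \in Bn n -> interior x1 =2 interior y1 ->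
      jspec x1 z j1 -> j1 \in Bn n -> ile y1 j2 -> ile z j2 ->
      forall a c, interior j1 a c -> interior j2 a c.
    move=> x1B j2B E J1 j1B y1j2 zj2; apply: interior_max; first exact: interior_sided.
    apply: (interior_join x1B zB j2B J1) => a c; last by move/interior_sub/zj2.
    by rewrite E => /interior_sub/y1j2.
  split=> // a c; apply/idP/idP; first exact: half _ _ _ _ xB j'B H J jB yj' zj' _ _.
  by apply: (half _ _ _ _ yB jB _ J' j'B xj zj) => e f; rewrite H.
- move=> x y z m m' zB [xB yB H] M M'; have [mB _ _ _] := M; have [m'B _ _ _] := M'.
  by split=> // a c; rewrite (interior_meet xB zB M) (interior_meet yB zB M') H.
Qed.

(** A criterion for the generating pairs: each gained inversion is blocked by an intermediate value
    and so stays outside the interior. *)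
Lemma same_interior_subset x y : x \in Bn n -> y \in Bn n -> ile x y ->
  (forall a c, inv y a c -> ~~ inv x a c -> exists b, [/\ ptval a < ptval b, ptval b < ptval c &
     ~~ (if side true b then inv y b c else inv y a b)]) -> same_interior x y.
Proof.
move=> xB yB xy H; split=> // a c; apply/idP/idP; first exact: interior_ile.
apply: interior_max; first exact: interior_sided.
move=> e f yef; have /interiorP[ief Hb] := yef; apply: contraT => nx.
by have [b [eb bf]] := H _ _ ief nx; rewrite Hb.
Qed.

(** Induction on c - a. If [y] missed the inversion (a, c) of [x], the dual of [y] would invert it
    outside its interior, so some b blocks it. Then [y] inverts one of (a, b), (b, c); sidedness of
    [x] and induction give the other, and transitivity contradicts the assumption. *)
Lemma dual_interior_ile x y : x \in Bn n -> y \in Bn n -> sided false (inv x) ->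
  interior (dual x) =2 interior (dual y) -> ile x y.
Proof.
move=> xB yB xs E.
suff K N a c : (absz (ptval c - ptval a)%R <= N)%N -> inv x a c -> inv y a c.
  by move=> a c; exact: K (leqnn _).
elim: N a c => [|N IH] a c HN xac; have ac := inv_lt xac; first by lia.
apply: contraT => nyac.
have /negbT : interior (dual y) a c = false by rewrite -E /interior inv_dual // xac andbF.
rewrite /interior inv_dual // ac nyac /= negb_forall => /existsP[b].
rewrite negb_imply => /andP[/andP[ab bc]]; have := xs _ _ _ ab bc xac.
have ytr := bicl_tr (inv_biclosed yB).
have -> : side false b = ~~ side true b by rewrite /side; case: (0 < _).
case: (side true b) => /= xb; rewrite inv_dual // ?ab ?bc /= negbK => yb;
  case/negP: nyac.
  by apply: ytr yb; apply: IH xb; move: HN ab bc; clear; lia.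
by apply: ytr yb _; apply: IH xb; move: HN ab bc; clear; lia.
Qed.

Lemma dual_interior_inj x y : x \in Bn n -> y \in Bn n ->
  sided false (inv x) -> sided false (inv y) -> interior (dual x) =2 interior (dual y) -> x = y.
Proof.
move=> xB yB xs ys E; apply: ile_anti => //; first exact: dual_interior_ile E.
by apply: dual_interior_ile => // a c; rewrite E.
Qed.

Lemma orbp_lt a c e f : ptval a < ptval c -> orbp a c e f -> ptval e < ptval f.
Proof. by move=> ac; rewrite orbpE; lia. Qed.

Definition cover x y a c := [/\ ptval a < ptval c, ~~ inv x a c &
  forall e f, inv y e f = inv x e f || orbp a c e f].

(** Take a violation (a, b, c) in which the places of c and a are closest. A value r placed between
    them would give the closer violation (r, b, c) or (a, b, r), so c and a are adjacent and can be
    exchanged. *)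
Lemma not_sided_cover sg y : y \in Bn n -> ~ sided sg (inv y) ->
  exists x a b c, [/\ x \in Bn n, cover x y a c, side sg b, ptval a < ptval b < ptval c &
     ~~ inv y b c].
Proof.
move=> yB ns.
pose bad (p : pt n * pt n) := [exists b, [&& ptval p.1 < ptval b, ptval b < ptval p.2, side sg b,
   inv y p.1 p.2 & ~~ inv y b p.2]].
have [p0 Hp0] : exists p : pt n * pt n, bad p.
  apply/existsP; apply: contra_notT ns; rewrite negb_exists => /forallP H.
  apply: sided_half => // a b c ab bc sb ac; apply: contraT => nbc.
  by have /existsP[] := H (a, c); exists b; rewrite /= ab bc sb ac nbc.
pose d (p : pt n * pt n) := absz (ptval (y^-1%g p.1) - ptval (y^-1%g p.2)).
have [[a c] /existsP[b /and5P[/= ab bc sb yac nbc]] Hmin] := arg_minnP d Hp0.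
have {}Hmin e f b' : ptval e < ptval b' -> ptval b' < ptval f -> side sg b' ->
    inv y e f -> ~~ inv y b' f -> (d (a, c) <= d (e, f))%N.
  by move=> eb bf sb' yef nbf; apply: Hmin; apply/existsP; exists b'; rewrite /= eb bf sb' yef.
have pca : ptval (y^-1%g c) < ptval (y^-1%g a) by have := yac; rewrite /inv => /andP[].
have pbc := ninv_pos bc nbc.
have Hadj : adj y c a.
  move=> r /andP[cr ra].
  case: (ltgtP (ptval r) (ptval b)) => [rb|br|/ptval_inj E].
  - have rc := lt_trans rb bc.
    have := Hmin r c b rb bc sb; rewrite inv_pos // cr => /(_ isT nbc).
    by rewrite /d /=; move: cr ra; clear; lia.
  - have ar := lt_trans ab br.
    have := Hmin a r b ab br sb; rewrite !inv_pos // ra -leNgt ltW ?(lt_trans pbc) // => /(_ isT isT).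
    by rewrite /d /=; move: cr ra; clear; lia.
  - by move: cr pbc; rewrite E; clear; lia.
have [x xB [nx Hx]] := adj_del yB yac Hadj.
by exists x, a, b, c; split=> //; [split=> //; exact: inv_lt yac | rewrite ab bc].
Qed.

End PatternClasses.

(** * Contracted covers *)

Section Contraction.
Variable n : nat.
Implicit Types (a b c e f p q r : pt n) (w x y z s t u : {perm pt n}) (k : 'I_n).

(** Sorts the values by an odd key, ties staying in increasing order. This is how the auxiliary
    elements of [cover_contraction] are built. *)
Lemma key_perm (key : pt n -> int) : (forall a, key (negpt a) = - key a) ->
  exists2 w, w \in Bn n & forall e f, inv w e f = (ptval e < ptval f) && (key f < key e).
Proof.
move=> kN; have [|w [m wm] E] := @realize n (fun e f => (ptval e < ptval f) && (key f < key e)).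
  split; first by move=> a c /andP[].
  - by move=> a b c; lia.
  - by move=> a b c -> -> /=; lia.
  - by move=> a c; rewrite !ptval_neg !kN !ltrN2.
by exists w => //; exact: prods_Bn wm.
Qed.

Definition valpair (u v : int) e f :=
  ((ptval e == u) && (ptval f == v)) || ((ptval e == - v) && (ptval f == - u)).

(* The value preceding b > 0 among the nonzero integers. *)
Definition pred_val (b : nat) : int := if b == 1%N then -1 else b%:Z - 1.

Lemma pred_valE (b : nat) :
  b = 1%N /\ pred_val b = -1 \/ b <> 1%N /\ pred_val b = b%:Z - 1.
Proof. by rewrite /pred_val; case: eqP => [->|]; [left | right]. Qed.

(* The inversions gained by the generating pair of the edge s_b -> s_{b-1}. *)
Definition step_pairs (b : nat) e f :=
  valpair (pred_val b) (b%:Z + 1) e f || (b == 1%N) && valpair (-2) 2 e f.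

(** The generating pairs are prescribed through inversion sets and not through words, so that the
    opposite orientation fits after dualizing; see [step_rel_edges1]. *)
Definition step_rel (R : {perm pt n} -> {perm pt n} -> Prop) :=
  forall b : nat, (0 < b < n)%N -> exists x y,
    [/\ R x y, inv x =2 valpair (pred_val b) b%:Z &
        inv y =2 (fun e f => valpair (pred_val b) b%:Z e f || step_pairs b e f)].

(* Inversions of the longest element of the parabolic subgroup that omits s_b. *)
Definition block_inv (b : nat) e f := (ptval e < ptval f) &&
  [|| b%:Z < ptval e, ptval f < - b%:Z | (- b%:Z <= ptval e) && (ptval f <= b%:Z)].

Lemma block_biclosed (b : nat) : biclosed (block_inv b).
Proof.
split.
- by move=> a c /andP[].
- by move=> a d c; rewrite /block_inv; lia.
- by move=> a d c ad dc; rewrite /block_inv ad dc /=; lia.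
- by move=> a c; rewrite /block_inv !ptval_neg; lia.
Qed.

(** Join the generating pair with the longest element of the parabolic subgroup. Its blocks are
    fully inverted, so chaining with the gained pair ([pred_val b], b + 1) inverts everything across
    the blocks, except pairs that start at b or end at -b. *)
Lemma block_contraction R (b : nat) : cong R -> step_rel R -> (0 < b < n)%N -> exists x y,
  [/\ R x y, inv x =2 block_inv b & forall e f, ptval e < ptval f ->
    ~ (ptval e = b%:Z /\ b%:Z < ptval f) -> ~ (ptval f = - b%:Z /\ ptval e < - b%:Z) -> inv y e f].
Proof.
move=> RC RS bn; have [x0 [y0 [Rxy x0E y0E]]] := RS b bn.
have [x0B y0B] := cong_Bn RC Rxy.
have [x [m xm] xE] := realize (block_biclosed b); have xB := prods_Bn xm.
have [y Hy] := join_exists y0B xB; have [yB y0y xy _] := Hy.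
have Rxy1 : R x y.
  apply: (cong_join RC xB Rxy _ Hy); apply: jspec_le => // e f.
  by rewrite x0E xE /valpair /block_inv; move: bn (pred_valE b); clear; lia.
exists x, y; split=> //.
have [ylt ytr _ yN] := inv_biclosed yB.
have [pb pbE] : exists p, ptval p = pred_val b.
  by apply: ptval_onto; move: bn (pred_valE b); clear; lia.
have [b1 b1E] : exists p : pt n, ptval p = b%:Z + 1 by apply: ptval_onto; lia.
have y_b1 : inv y pb b1.
  by apply: y0y; rewrite y0E /step_pairs /valpair pbE b1E !eqxx orbT.
have y_up e f : - b%:Z <= ptval e < b%:Z -> b%:Z < ptval f -> inv y e f.
  move=> e_le f_gt; have e0 := @ptval_neq0 _ e.
  have y_epb : e = pb \/ inv y e pb.
    case: (eqVneq e pb) => [|epb]; [by left | right].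
    apply: xy; rewrite xE /block_inv pbE; move: epb; rewrite eq_ptval pbE.
    by move: e_le e0 bn (pred_valE b); clear; lia.
  have y_b1f : b1 = f \/ inv y b1 f.
    case: (eqVneq b1 f) => [|b1f]; [by left | right].
    apply: xy; rewrite xE /block_inv b1E; move: b1f; rewrite eq_ptval b1E.
    by move: f_gt; clear; lia.
  case: y_epb => [->|y_epb]; case: y_b1f => [<-|y_b1f] //.
  - exact: ytr y_b1f.
  - exact: ytr y_epb _.
  - exact: ytr y_epb (ytr _ _ _ y_b1 y_b1f).
have y_down e f : ptval e < - b%:Z -> - b%:Z < ptval f <= b%:Z -> inv y e f.
  move=> e_lt f_le; rewrite -(negptK e) -(negptK f); apply: yN.
  by apply: y_up; rewrite ptval_neg; move: e_lt f_le; clear; lia.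
move=> e f ef H1 H2; have e0 := @ptval_neq0 _ e; have f0 := @ptval_neq0 _ f.
case: (ltP b%:Z (ptval f)) => bf; last first.
  case: (ltP (ptval e) (- b%:Z)) => be; last first.
    by apply: xy; rewrite xE /block_inv ef be bf !orbT.
  case: (ltP (- b%:Z) (ptval f)) => bf'; first by apply: y_down; rewrite // bf' bf.
  case: (ltP (ptval f) (- b%:Z)) => bf''; first by apply: xy; rewrite xE /block_inv ef bf'' !orbT.
  by case: H2; move: bf' bf'' be; clear; lia.
case: (ltP b%:Z (ptval e)) => be; first by apply: xy; rewrite xE /block_inv ef be.
case: (ltP (ptval e) (- b%:Z)) => be'; last first.
  by apply: y_up => //; rewrite be'; move: be H1 bf; clear; lia.
(* For b = 1 the value [pred_val b] is -b itself and cannot serve as the link between the outer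
   blocks; the extra gained pair (-2, 2) does. *)
case: (eqVneq b 1%N) => b1'.
  have [m2 m2E] : exists p : pt n, ptval p = -2 by apply: ptval_onto; lia.
  have [p2 p2E] : exists p : pt n, ptval p = 2 by apply: ptval_onto; lia.
  have y_22 : inv y m2 p2.
    by apply: y0y; rewrite y0E /step_pairs /valpair m2E p2E b1' !eqxx !orbT.
  have y_em : e = m2 \/ inv y e m2.
    case: (eqVneq e m2) => [|em]; [by left | right].
    apply: xy; rewrite xE /block_inv m2E; move: em be'; rewrite eq_ptval m2E b1'; clear; lia.
  have y_pf : p2 = f \/ inv y p2 f.
    case: (eqVneq p2 f) => [|pf]; [by left | right].
    apply: xy; rewrite xE /block_inv p2E; move: pf bf; rewrite eq_ptval p2E b1'; clear; lia.
  case: y_em => [->|y_em]; case: y_pf => [<-|y_pf] //.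
  - exact: ytr y_pf.
  - exact: ytr y_em _.
  - exact: ytr y_em (ytr _ _ _ y_22 y_pf).
apply: (ytr _ pb).
  by apply: y_down; rewrite // pbE; move: bn b1' (pred_valE b); clear; lia.
by apply: y_up; rewrite // pbE; move: bn b1' (pred_valE b); clear; lia.
Qed.

(* A non-inversion of z is a chain of non-inversions of x and y; such a chain
   cannot leave T. *)
Lemma meet_separation x y z (T : pred (pt n)) a c : x \in Bn n -> y \in Bn n -> mspec x y z ->
  (forall e f, ptval e < ptval f -> ~~ inv x e f -> T e -> T f) ->
  (forall e f, ptval e < ptval f -> ~~ inv y e f -> T e -> T f) ->
  ptval a < ptval c -> T a -> ~~ T c -> inv z a c.
Proof.
move=> xB yB Hz xT yT ac Ta nTc; apply: contraT => nz.
suff : T a ==> T c by rewrite Ta (negPf nTc).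
apply: (mspec_min (N := fun e f => T e ==> T f) xB yB Hz _ _ _ ac nz).
- by move=> e f g; case: (T e) => //= ->.
- by move=> e f ef nx; apply/implyP; exact: xT.
- by move=> e f ef ny; apply/implyP; exact: yT.
Qed.

(** The pair of [block_contraction] for b is cut down by a meet with [w]; the inversion (a, c)
    survives in the upper element by [meet_separation]. *)
Lemma contraction_below R w a b c : cong R -> step_rel R -> w \in Bn n ->
  0 < ptval b -> ptval a < ptval b < ptval c -> ~~ inv w b c -> inv w a c ->
  - ptval b <= ptval a \/ inv w (negpt b) c ->
  exists x y, [/\ R x y, ile x w, forall e f, inv x e f -> block_inv (absz (ptval b)) e f,
    ile y w & inv y a c].
Proof.
move=> RC RS wB b0 /andP[ab bc] nbc wac Hab.
set bt := absz (ptval b); have btE : ptval b = bt%:Z by rewrite /bt; lia.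
have bn : (0 < bt < n)%N by have := ptval_bound c; lia.
have [x1 [y1 [Rxy x1E y1E]]] := block_contraction RC RS bn; have [x1B y1B] := cong_Bn RC Rxy.
have [x Hx] := meet_ex x1B wB; have [y Hy] := meet_ex y1B wB.
exists x, y; have [_ xx1 xw _] := Hx; have [_ _ yw _] := Hy; split=> //.
- exact: (cong_meet RC wB Rxy Hx Hy).
- by move=> e f /xx1; rewrite x1E.
have ac := lt_trans ab bc.
have pb := ninv_pos bc nbc; have pc : ptval (w^-1%g c) < ptval (w^-1%g a) by case/andP: wac.
(* The non-inversions of [y1] start at b or end at -b. The first kind cannot leave [T], since b is
   placed before c; for the second, the disjunct ensures that -b belongs to [T] as soon as some
   smaller value does. *)
pose T e := (ptval (w^-1%g c) < ptval (w^-1%g e)) && ((- ptval b <= ptval e) || inv w (negpt b) c).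
apply: (@meet_separation y1 w y T) => //.
- move=> e f ef; case: (eqVneq e b) => [->|eb]; first by rewrite /T ltNge (ltW pb).
  case: (eqVneq f (negpt b)) => [fb|fb] ny.
    rewrite fb in ef *; move=> /andP[_ /orP[|H]]; first by move: ef; rewrite ptval_neg; lia.
    by rewrite /T H orbT; move: H => /andP[_ ->].
  case/negP: ny; apply: y1E => // -[E _]; first by case/eqP: eb; apply: ptval_inj; rewrite btE.
  by case/eqP: fb; apply: ptval_inj; rewrite ptval_neg btE.
- move=> e f ef /(ninv_pos ef) pef /andP[pe H]; rewrite /T (lt_trans pe pef) /=.
  by case/orP: H => [H|->]; rewrite ?orbT //; rewrite (le_trans H (ltW ef)).
- by rewrite /T pc; case: Hab => ->; rewrite ?orbT.
- by rewrite /T ltxx.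
Qed.

(** With [cover_ile], this carries a congruence to a cover: a related pair below [y], of which only
    the upper member inverts (a, c), becomes ([x], [y]) after joining with [x]. *)
Lemma cover_join x y z a c : cover x y a c -> x \in Bn n -> y \in Bn n -> z \in Bn n ->
  ile z y -> inv z a c -> jspec z x y.
Proof.
move=> [ac nac E] xB yB zB zy zac; split=> //.
  by move=> e f; rewrite E => ->.
move=> u uB zu xu e f; rewrite E => /orP[/xu//|].
case/orP => /andP[/eqP-> /eqP->]; first exact: zu.
by apply: bicl_neg (inv_biclosed uB) _ _ _; exact: zu.
Qed.

Lemma cover_ile x y z a c : cover x y a c -> z \in Bn n ->
  ile z y -> ~~ inv z a c -> ile z x.
Proof.
move=> [ac nac E] zB zy nz e f zef; have := zy _ _ zef; rewrite E => /orP[//|].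
case/orP => /andP[/eqP eE /eqP fE]; case/negP: nz; rewrite eE fE in zef => //.
by have := bicl_neg (inv_biclosed zB) zef; rewrite !negptK.
Qed.

Lemma cover_between x y a b c : cover x y a c -> x \in Bn n -> y \in Bn n ->
  ptval a < ptval b < ptval c -> inv x a b || inv x b c.
Proof.
move=> [ac nac E] xB yB /andP[ab bc].
have yac : inv y a c by rewrite E orbp_refl orbT.
have := bicl_co (inv_biclosed yB) ab bc yac; rewrite !E.
case: (boolP (orbp a c a b)) => [|_]; first by rewrite orbpE; lia.
case: (boolP (orbp a c b c)) => [|_]; first by rewrite orbpE; lia.
by rewrite !orbF.
Qed.

Lemma cover_contraction R x y a b c : cong R -> step_rel R -> x \in Bn n -> y \in Bn n ->
  cover x y a c -> 0 < ptval b -> ptval a < ptval b < ptval c -> ~~ inv y b c -> R x y.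
Proof.
move=> RC RS xB yB xy b0 abc nbc; have [ac nac E] := xy; have /andP[ab bc] := abc.
have yac : inv y a c by rewrite E orbp_refl orbT.
have xley : ile x y by move=> e f; rewrite E => ->.
case: (boolP ((- ptval b <= ptval a) || inv y (negpt b) c)) => [/orP H|].
  have [x2 [y2 [R2 x2y x2b y2y y2ac]]] := contraction_below RC RS yB b0 abc nbc yac H.
  have [x2B y2B] := cong_Bn RC R2.
  apply: (cong_join RC xB R2); last exact: cover_join xy xB yB y2B y2y y2ac.
  apply: jspec_le => //; apply: cover_ile xy x2B x2y _.
  by apply/negP => /x2b; rewrite /block_inv; move: b0 ab bc; clear; lia.
rewrite negb_or -ltNge => /andP[anb nnbc].
have nb_c : ptval (negpt b) < ptval c by rewrite ptval_neg; move: b0 bc; clear; lia.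
have xab : inv x a b.
  by case/orP: (cover_between xy xB yB abc) => // /xley; rewrite (negPf nbc).
have xanb : inv x a (negpt b).
  have /orP[//|/xley] : inv x a (negpt b) || inv x (negpt b) c.
    by apply: cover_between xy xB yB _; rewrite nb_c ptval_neg anb.
  by rewrite (negPf nnbc).
pose P e := ptval (x^-1%g e).
have PN e : P (negpt e) = - P e by exact: pos_neg.
have Pba : P b < P a by case/andP: xab.
have Pnba : - P b < P a by rewrite -PN; case/andP: xanb.
have Pac : P a < P c by exact: ninv_pos.
have Pinj e f : P e = P f -> e = f by move/ptval_inj/perm_inj.
(* Here a < -b, and x reads .. -c -a .. a c .. with b and -b between.  Let v be x
   with everything between sorted decreasingly, and w be v with c moved to just
   before -b: contraction_below applies to w and (-b, c), while v inverts (a, -b). *)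
pose key e := if (- P a < P e < P a) then - ptval e
              else if 0 < P e then P e + n%:Z else P e - n%:Z.
have keyN e : key (negpt e) = - key e.
  rewrite /key PN ptval_neg; have : P e <> 0 by exact: ptval_neq0.
  by move: (P e) (P a) => i j; clear; do ?case: ifP => ?; lia.
have [v vB vE] := key_perm keyN.
pose bv := ptval b.
have key_b : key (negpt b) = bv by rewrite keyN /key Pba ltrNl Pnba opprK.
have key_a : key a = P a + n%:Z.
  by rewrite /key ltxx andbF; case: ifP => //; move: Pba Pnba; clear; lia.
have key_c : key c = P c + n%:Z.
  by rewrite /key; move: Pac Pba Pnba; clear; do ?case: ifP => ?; lia.
have bvn : bv <= n%:Z by have /andP[] := ptval_bound b.
have xv : ile x v.
  move=> e f /andP[ef]; rewrite -/(P e) -/(P f) vE ef /key.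
  have := ptval_bound e; have := ptval_bound f.
  have : 0 < P a by move: Pba Pnba; clear; lia.
  by move: ef; clear; do ?case: ifP => ?; lia.
have nvac : ~~ inv v a c by rewrite vE key_a key_c negb_and -!leNgt; move: Pac; clear; lia.
have vanb : inv v a (negpt b).
  by rewrite vE key_a key_b ptval_neg anb; move: bvn Pba Pnba; clear; lia.
(* Doubling makes room for c right before -b, whose doubled key is [2 * bv]. *)
pose key' e := if e == c then 2 * bv - 1 else if e == negpt c then 1 - 2 * bv else 2 * key e.
have c_nc : (negpt c == c) = false.
  by rewrite eq_ptval ptval_neg; have := @ptval_neq0 _ c; clear; lia.
have key'N e : key' (negpt e) = - key' e.
  rewrite /key' keyN (inj_eq (can_inj (@negptK n))).
  case: (eqVneq e c) => [->|ec]; first by rewrite c_nc; clear; lia.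
  rewrite -(inj_eq (can_inj (@negptK n)) e) negptK.
  by case: ifP => _; clear; lia.
have [w wB wE] := key_perm key'N.
have key'_b : key' (negpt b) = 2 * bv.
  rewrite /key' !eq_ptval !ptval_neg key_b; move: bc b0; clear; case: eqP; [lia|].
  by case: eqP; lia.
have wnbc : inv w (negpt b) c by rewrite wE nb_c key'_b /key' eqxx; clear; lia.
have nwbc : ~~ inv w b c.
  rewrite wE bc /= -leNgt -(negptK b) key'N key'_b /key' eqxx; move: b0; rewrite -/bv; clear; lia.
have [||x2 [y2 [R2 x2w x2b y2w y2bc]]] := contraction_below RC RS wB b0 _ nwbc wnbc.
- by rewrite bc ptval_neg; move: b0; clear; lia.
- by left; rewrite ptval_neg.
have [x2B y2B] := cong_Bn RC R2.
(* Moving c could create inversions (e, c) absent from [v], but none with e above b: such an e is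
   placed in [x] before a or after c. The inversions of [x2] respect the blocks of b, so [x2] stays
   below [v]. *)
have w_v e : inv w e c -> bv < ptval e -> key c < key e.
  rewrite wE /key' eqxx => /andP[ec] + be.
  case: eqP => [E'|_]; first by rewrite E' ltxx in ec.
  case: eqP => [E'|_]; first by move: be b0 bc; rewrite E' ptval_neg -/bv; clear; lia.
  move=> He; rewrite ltNge; apply/negP => kec.
  have /orP[] : inv x a e || inv x e c.
  - by apply: cover_between xy xB yB _; rewrite ec (lt_trans ab be).
    rewrite /inv -/(P e) -/(P a) => /andP[_ Pea]; move: He; rewrite /key.
    by move: be b0 Pea; rewrite -/bv; clear; do ?case: ifP => ?; lia.
  rewrite /inv -/(P e) -/(P c) => /andP[_ Pce]; move: kec; rewrite key_c /key.
  by move: Pce Pac Pba Pnba; clear; do ?case: ifP => ?; lia.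
have x2v : ile x2 v.
  move=> e f x2ef; have wef := x2w _ _ x2ef; have := x2b _ _ x2ef.
  have b_abs : (absz (ptval b))%:Z = bv by rewrite /bv; move: b0; clear; lia.
  rewrite /block_inv b_abs => bl; have ef := inv_lt wef; rewrite vE ef /=.
  case: (eqVneq f c) => [fc|fc].
    by rewrite fc in wef bl *; apply: w_v wef _; move: bl bc b0; rewrite -/bv; clear; lia.
  case: (eqVneq e (negpt c)) => [enc|enc].
    have := bicl_neg (inv_biclosed wB) wef; rewrite enc negptK => /w_v.
    rewrite enc ptval_neg in bl; rewrite keyN keyN ptval_neg => H.
    suff /H : bv < - ptval f by clear; lia.
    by move: bl bc b0; rewrite -/bv; clear; lia.
  move: wef; rewrite wE ef /= /key' (negPf fc) (negPf enc).
  case: (eqVneq e c) => [->|_]; case: (eqVneq f (negpt c)) => [->|_].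
  - by rewrite keyN key_c; move: Pac Pba Pnba; clear; lia.
  - by rewrite key_c; move: bvn Pac Pba Pnba; clear; lia.
  - by rewrite keyN key_c; move: bvn Pac Pba Pnba; clear; lia.
  - by clear; lia.
have [j Hj] := join_exists y2B vB; have [jB y2j vj _] := Hj.
have Rvj : R v j by apply: (cong_join RC vB R2 _ Hj); exact: jspec_le.
have jac : inv j a c.
  have H1 := vj _ _ vanb; have H2 := y2j _ _ y2bc;  exact (bicl_tr (inv_biclosed jB) H1 H2).
(* The meet of [v] with [y] is [x], because [v] does not invert (a, c); the meet of [j] with [y] is
   [y], because [j] lies above [x] and inverts (a, c). *)
apply: (cong_meet RC yB Rvj).
  split=> // u uB uv uy; apply: cover_ile xy uB uy _.
  by apply: contra nvac; exact: uv.
apply: mspecC; apply: mspec_le => //.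
have [_ _ _ Hmin] := cover_join xy xB yB yB (ile_refl (x := y)) yac.
move=> e f; rewrite E => /orP[/xv/vj//|/orP[] /andP[/eqP-> /eqP->] //].
exact: bicl_neg (inv_biclosed jB) _ _ jac.
Qed.

End Contraction.

(** * Generating pairs *)

Section Generators.
Variable n : nat.
Implicit Types (a c e f p q r : pt n) (w x y z s t u : {perm pt n}) (k : 'I_n) (b : nat).

Lemma inv_gen_val w k (u v : int) : w \in Bn n -> ptval (w (lo k)) = u -> ptval (w (hi k)) = v ->
  u < v -> inv (gen n k * w)%g =2 (fun e f => inv w e f || valpair u v e f).
Proof. by move=> wB <- <- uv e f; rewrite inv_gen // orbpE. Qed.

Lemma inv_gen1 k : inv (gen n k) =2 valpair (ptval (lo k)) (ptval (hi k)).
Proof.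
move=> e f; rewrite -[gen n k]mulg1.
by rewrite (inv_gen_val (Bn1 n) erefl erefl) ?perm1 ?ptval_lt_lohi // inv1.
Qed.

Lemma gen_predE b : (0 < b < n)%N -> inv (gen n b.-1) =2 valpair (pred_val b) b%:Z.
Proof.
move=> bn e f; have jn : (b.-1 < n)%N by lia.
rewrite -[b.-1]/(nat_of_ord (Ordinal jn)) inv_gen1 ptval_lo ptval_hi /= prednK; last lia.
by congr valpair; have := pred_valE b; case: eqP; lia.
Qed.

Lemma gen_valE b : (0 < b < n)%N -> inv (gen n b) =2 valpair b%:Z (b%:Z + 1).
Proof.
move=> bn e f; have jn : (b < n)%N by lia.
rewrite -[b]/(nat_of_ord (Ordinal jn)) inv_gen1 ptval_lo ptval_hi /=.
by congr valpair; [case: eqP; lia | lia].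
Qed.

Lemma ptval_gen_eq k a (v : int) : ptval a = v -> ptval (gen n k a) =
  if v == ptval (hi k) then ptval (lo k) else if v == ptval (lo k) then ptval (hi k) else
  if v == - ptval (hi k) then - ptval (lo k) else
  if v == - ptval (lo k) then - ptval (hi k) else v.
Proof. by move=> <-; exact: ptval_gen. Qed.

Lemma gen_Bn_nat b : (b < n)%N -> gen n b \in Bn n.
Proof. by move=> bn; exact: gen_Bn (Ordinal bn). Qed.

(** Each letter multiplied on the left adds one orbit of inversions; for b = 1 the three orbits are
    those of (-1, 1), (-1, 2) and (-2, 2). *)
Lemma dword_downE b : (0 < b < n)%N -> dword n b b.-1 \in Bn n /\
  inv (dword n b b.-1) =2 (fun e f => valpair (pred_val b) b%:Z e f || step_pairs b e f).
Proof.
move=> bn; have jn : (b.-1 < n)%N by lia.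
have in_ : (b < n)%N by lia.
pose i := Ordinal in_; pose j := Ordinal jn.
have [iB jB] := (gen_Bn i, gen_Bn j).
case: (eqVneq b 1%N) => b1; last first.
  have -> : dword n b b.-1 = (gen n i * gen n j)%g by rewrite /dword; case: ifP => //; lia.
  split; first exact: BnM.
  move=> e f; rewrite (@inv_gen_val _ _ (pred_val b) (b%:Z + 1)) //.
  - by rewrite gen_predE // /step_pairs (negPf b1) orbF.
  - have E : ptval (lo i) = b%:Z by rewrite ptval_lo /=; case: eqP; lia.
    by rewrite (ptval_gen_eq j E) ptval_hi ptval_lo /= prednK ?eqxx; last lia;
      have := pred_valE b; case: eqP; lia.
  - have E : ptval (hi i) = b%:Z + 1 by rewrite ptval_hi /=; lia.
    rewrite (ptval_gen_eq j E) ptval_hi ptval_lo /= (_ : (b.-1 == 0)%N = false); last lia.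
    by do ?case: eqP => ?; lia.
  - by have := pred_valE b; lia.
have [iE jE] : nat_of_ord i = 1%N /\ nat_of_ord j = 0%N by rewrite /= b1.
have -> : dword n b b.-1 = (gen n j * (gen n i * gen n j))%g by rewrite iE jE b1 /dword /= mulgA.
have lj : ptval (lo j) = -1 by rewrite ptval_lo /= b1.
have hj : ptval (hi j) = 1 by rewrite ptval_hi /= b1.
have li : ptval (lo i) = 1 by rewrite ptval_lo /= b1.
have hi_ : ptval (hi i) = 2 by rewrite ptval_hi /= b1.
split; first by rewrite !BnM.
move=> e f; rewrite (@inv_gen_val _ _ (-2) 2) ?BnM //.
- rewrite (@inv_gen_val _ _ (-1) 2) //.
  + by rewrite gen_predE // /step_pairs b1 /= orbA.
  + by rewrite (ptval_gen_eq j li) lj hj.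
  + by rewrite (ptval_gen_eq j hi_) lj hj.
- rewrite permM (ptval_gen_eq j (v := -2)) ?lj ?hj //.
  by rewrite (ptval_gen_eq i lj) li hi_.
- rewrite permM (ptval_gen_eq j (v := 2)) ?lj ?hj //.
  by rewrite (ptval_gen_eq i hj) li hi_.
Qed.

(** The pairs gained are the same [step_pairs] as for the reversed edge, which is what makes the two
    orientations dual to each other. *)
Lemma dword_upE b : (0 < b < n)%N -> dword n b.-1 b \in Bn n /\
  inv (dword n b.-1 b) =2 (fun e f => valpair b%:Z (b%:Z + 1) e f || step_pairs b e f).
Proof.
move=> bn; have jn : (b.-1 < n)%N by lia.
have in_ : (b < n)%N by lia.
pose i := Ordinal in_; pose j := Ordinal jn.
have [iB jB] := (gen_Bn i, gen_Bn j).
case: (eqVneq b 1%N) => b1; last first.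
  have -> : dword n b.-1 b = (gen n j * gen n i)%g by rewrite /dword; case: ifP => //; lia.
  split; first exact: BnM.
  move=> e f; rewrite (@inv_gen_val _ _ (pred_val b) (b%:Z + 1)) //.
  - by rewrite gen_valE // /step_pairs (negPf b1) orbF.
  - have E : ptval (lo j) = pred_val b.
      by rewrite ptval_lo /=; have := pred_valE b; case: eqP; lia.
    rewrite (ptval_gen_eq i E) ptval_hi ptval_lo /= (_ : (b == 0)%N = false); last lia.
    by have := pred_valE b; do ?case: eqP => ?; lia.
  - have E : ptval (hi j) = b%:Z by rewrite ptval_hi /=; lia.
    rewrite (ptval_gen_eq i E) ptval_hi ptval_lo /= (_ : (b == 0)%N = false); last lia.
    by do ?case: eqP => ?; lia.
  - by have := pred_valE b; lia.
have [iE jE] : nat_of_ord i = 1%N /\ nat_of_ord j = 0%N by rewrite /= b1.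
have -> : dword n b.-1 b = (gen n i * (gen n j * gen n i))%g by rewrite iE jE b1 /dword /= mulgA.
have lj : ptval (lo j) = -1 by rewrite ptval_lo /= b1.
have hj : ptval (hi j) = 1 by rewrite ptval_hi /= b1.
have li : ptval (lo i) = 1 by rewrite ptval_lo /= b1.
have hi_ : ptval (hi i) = 2 by rewrite ptval_hi /= b1.
split; first by rewrite !BnM.
move=> e f; rewrite (@inv_gen_val _ _ (-2) 1) ?BnM //.
- rewrite (@inv_gen_val _ _ (-2) 2) //.
  + by rewrite gen_valE // /step_pairs /valpair /pred_val /= b1 /=; clear; lia.
  + by rewrite (ptval_gen_eq i lj) li hi_.
  + by rewrite (ptval_gen_eq i hj) li hi_.
- rewrite permM (ptval_gen_eq i (v := -1)) ?li ?hi_ //.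
  by rewrite (ptval_gen_eq j li) lj hj.
- rewrite permM (ptval_gen_eq i (v := 2)) ?li ?hi_ //.
  by rewrite (ptval_gen_eq j hi_) lj hj.
Qed.

Definition contracts_edges (E : nat -> nat -> bool) (R : {perm pt n} -> {perm pt n} -> Prop) :=
  forall i j, E i j -> R (gen n j) (dword n i j).

Lemma step_rel_edges2 R : contracts_edges (edges2 n) R -> step_rel R.
Proof.
move=> RE b bn; exists (gen n b.-1), (dword n b b.-1).
split; [apply: RE; rewrite /edges2; lia | exact: gen_predE | by case: (dword_downE bn)].
Qed.

(** Let x, y be the generating pair of the reversed edge. Their duals differ exactly by
    [step_pairs], so joining the pair contracted by [R] with the dual of y yields the dual of y and
    the dual of x. *)
Lemma step_rel_edges1 R : cong R -> contracts_edges (edges1 n) R ->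
  step_rel (fun x y => R (dual x) (dual y)).
Proof.
move=> RC RE b bn; exists (gen n b.-1), (dword n b b.-1).
have [yB yE] := dword_downE bn; have [y'B y'E] := dword_upE bn.
have xE := gen_predE bn; have x'E := gen_valE bn.
have xB : gen n b.-1 \in Bn n by apply: gen_Bn_nat; lia.
have x'B : gen n b \in Bn n by apply: gen_Bn_nat; lia.
split=> //; apply: cong_sym => //.
have Rx'y' : R (gen n b) (dword n b.-1 b) by apply: RE; rewrite /edges1; lia.
apply: (cong_join RC (dual_Bn yB) Rx'y').
  apply: jspec_le => [|e f]; first exact: dual_Bn.
  by rewrite x'E inv_dual // yE /step_pairs /valpair; have := pred_valE b; lia.
split; first exact: dual_Bn.
- by move=> e f; rewrite y'E inv_dual // xE /step_pairs /valpair; have := pred_valE b; lia.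
- by move=> e f; rewrite !inv_dual // xE yE; case: (valpair _ _ e f); rewrite ?andbF //= => /andP[->].
- move=> u uB y'u yu e f; rewrite inv_dual // xE => /andP[ef nv].
  case: (boolP (step_pairs b e f)) => ns; first by apply: y'u; rewrite y'E ns orbT.
  by apply: yu; rewrite inv_dual // yE ef negb_or nv ns.
Qed.

(** The blocking value is b when f = b + 1 and -b otherwise. The pair that decides it is inverted by
    $s_b$, and so is absent from the word of the edge towards $s_{b-1}$. *)
Lemma step_pairs_between b e f : (0 < b < n)%N -> step_pairs b e f -> exists d,
  [/\ ptval e < ptval d, ptval d < ptval f &
    if side true d then valpair b%:Z (b%:Z + 1) d f else valpair b%:Z (b%:Z + 1) e d].
Proof.
move=> bn ef; have [d dE] : exists d : pt n, ptval d = b%:Z by apply: ptval_onto; lia.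
have pv := pred_valE b.
case: (eqVneq (ptval f) (b%:Z + 1)) => fE.
  exists d; rewrite /side dE; split; last by rewrite /valpair dE fE; move: bn; clear; case: ifP; lia.
    by move: ef pv bn; rewrite /step_pairs /valpair; clear; lia.
  by rewrite fE; clear; lia.
exists (negpt d); rewrite side_neg /side ptval_neg dE; split.
- by move: ef pv bn fE; rewrite /step_pairs /valpair; clear; lia.
- by move: ef pv bn fE; rewrite /step_pairs /valpair; clear; lia.
- move: ef pv bn fE; rewrite /step_pairs /valpair ptval_neg dE; clear; case: ifP; lia.
Qed.

Lemma same_interior_edges2 : contracts_edges (edges2 n) (@same_interior n).
Proof.
move=> b j /andP[/eqP bE bn']; have bn : (0 < b < n)%N by rewrite bE; rewrite bE in bn'; lia.
have -> : j = b.-1 by rewrite bE.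
have [yB yE] := dword_downE bn; have xE := gen_predE bn.
have xB : gen n b.-1 \in Bn n by apply: gen_Bn_nat; lia.
apply: same_interior_subset => // [e f|e f]; first by rewrite xE yE => ->.
rewrite yE xE => /orP[->//|sp _]; have [d [ed df Hd]] := step_pairs_between bn sp.
exists d; split=> //; rewrite !yE; move: Hd; have := pred_valE b.
by rewrite /step_pairs /valpair; move: bn ed df; clear; case: ifP => _; lia.
Qed.

Lemma same_interior_edges1 :
  contracts_edges (edges1 n) (fun x y => same_interior (dual x) (dual y)).
Proof.
move=> i b /andP[/eqP bE bn']; have bn : (0 < b < n)%N by rewrite bE; rewrite bE in bn'; lia.
have -> : i = b.-1 by rewrite bE.
have [yB yE] := dword_upE bn; have xE := gen_valE bn.
have xB : gen n b \in Bn n by apply: gen_Bn_nat; lia.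
apply: cong_sym; first exact: same_interior_cong.
apply: same_interior_subset; try exact: dual_Bn.
  by apply/ile_dual => // e f; rewrite xE yE => ->.
move=> e f; rewrite !inv_dual // xE yE => /andP[-> nv] /=; rewrite (negPf nv) /= negbK => sp.
have [d [ed df Hd]] := step_pairs_between bn sp; exists d; split=> //.
by rewrite !inv_dual // !xE ed df /=; move: Hd; case: ifP => _ ->.
Qed.

End Generators.

(** * Signed patterns *)

Section Patterns.
Variable n : nat.
Implicit Types (a b c e f p q r : pt n) (w x y z s t u : {perm pt n}).

Definition entry x (i : 'I_n) : int := ptval (x (i, false)).

Lemma sorted_enum_ord : sorted (relpre val ltn) (enum 'I_n).
Proof. by rewrite -sorted_map val_enum_ord iota_ltn_sorted. Qed.

Lemma subseq_enum_ord (l : seq 'I_n) : subseq l (enum 'I_n) = sorted (relpre val ltn) l.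
Proof.
have tr : transitive (relpre val ltn : rel 'I_n) by move=> i j k /=; exact: ltn_trans.
apply/idP/idP => [H|H]; first exact: subseq_sorted tr _ _ H sorted_enum_ord.
have -> : l = [seq i <- enum 'I_n | i \in l]; last exact: filter_subseq.
apply: (irr_sorted_eq tr) => //; first by move=> i /=; rewrite ltnn.
  exact: sorted_filter tr _ _ sorted_enum_ord.
by move=> i; rewrite mem_filter mem_enum andbT.
Qed.

Lemma containsP x (y : seq int) : reflect
  (exists2 l : seq 'I_n, sorted (relpre val ltn) l & std_eq (map (entry x) l) y) (contains x y).
Proof.
apply: (iffP existsP) => [[m Hm]|[l]].
  exists (mask m (enum 'I_n)); last by rewrite map_mask.
  by rewrite -subseq_enum_ord mask_subseq.
rewrite -subseq_enum_ord => /subseqP[m sm ->]; rewrite map_mask => Hy.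
have sm' : size m == n by rewrite sm size_enum_ord.
by exists (Tuple sm').
Qed.

Lemma forall_ord2 (P : pred 'I_2) :
  [forall i : 'I_2, P i] = P (Ordinal (isT : 0 < 2)%N) && P (Ordinal (isT : 1 < 2)%N).
Proof.
apply/forallP/andP => [H|[H0 H1] [[|[|i]] Hi]]; [by split | | | by []].
  by have -> : Ordinal Hi = Ordinal (isT : 0 < 2)%N by exact: val_inj.
by have -> : Ordinal Hi = Ordinal (isT : 1 < 2)%N by exact: val_inj.
Qed.

Lemma forall_ord3 (P : pred 'I_3) : [forall i : 'I_3, P i] =
  [&& P (Ordinal (isT : 0 < 3)%N), P (Ordinal (isT : 1 < 3)%N) & P (Ordinal (isT : 2 < 3)%N)].
Proof.
apply/forallP/and3P => [H|[H0 H1 H2] [[|[|[|i]]] Hi]]; [by split | | | | by []].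
- by have -> : Ordinal Hi = Ordinal (isT : 0 < 3)%N by exact: val_inj.
- by have -> : Ordinal Hi = Ordinal (isT : 1 < 3)%N by exact: val_inj.
- by have -> : Ordinal Hi = Ordinal (isT : 2 < 3)%N by exact: val_inj.
Qed.

Definition std2 (u0 u1 v0 v1 : int) : bool :=
  [&& (u0 < 0) == (v0 < 0), (u1 < 0) == (v1 < 0),
      (absz u0 < absz u1)%N == (absz v0 < absz v1)%N &
      (absz u1 < absz u0)%N == (absz v1 < absz v0)%N].

Definition std3 (u0 u1 u2 v0 v1 v2 : int) : bool :=
  [&& std2 u0 u1 v0 v1, std2 u0 u2 v0 v2 & std2 u1 u2 v1 v2].

Lemma contains2P x v0 v1 : contains x [:: v0; v1] <->
  exists i j : 'I_n, (i < j)%N /\ std2 (entry x i) (entry x j) v0 v1.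
Proof.
have E (u0 u1 : int) : std_eq [:: u0; u1] [:: v0; v1] = std2 u0 u1 v0 v1.
  rewrite /std_eq /= forall_ord2 !forall_ord2 /= !ltnn !eqxx /= /std2.
  by case: (_ == _); case: (_ == _); rewrite ?andbT ?andbF //= andbC.
split=> [/containsP[[|i [|j [|k l]]] //= Hs]|[i [j [ij H]]]].
- by rewrite andbT in Hs; rewrite E => H; exists i, j.
- by apply/containsP; exists [:: i; j] => /=; rewrite ?ij // E.
Qed.

Lemma contains3P x v0 v1 v2 : contains x [:: v0; v1; v2] <->
  exists i j k : 'I_n, [/\ (i < j)%N, (j < k)%N &
    std3 (entry x i) (entry x j) (entry x k) v0 v1 v2].
Proof.
have E (u0 u1 u2 : int) : std_eq [:: u0; u1; u2] [:: v0; v1; v2] = std3 u0 u1 u2 v0 v1 v2.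
  rewrite /std_eq /= forall_ord3 !forall_ord3 /= !ltnn !eqxx /= /std3 /std2.
  by apply/idP/idP; repeat (case: (_ == _) => //=).
split=> [/containsP[[|i [|j [|k [|m l]]]] //= Hs]|[i [j [k [ij jk H]]]]].
- by move: Hs; rewrite andbT => /andP[ij jk]; rewrite E => H; exists i, j, k.
- by apply/containsP; exists [:: i; j; k] => /=; rewrite ?ij ?jk // E.
Qed.

Lemma avoids_allP x (pats : seq (seq int)) : reflect (x \in Bn n /\ forall y : seq int, y \in pats -> ~ contains x y)
  (x \in avoids_all n pats).
Proof.
rewrite [x \in avoids_all _ _]in_set; apply: (iffP andP) => -[xB H]; split=> //.
  by move=> y /(allP H)/negP.
by apply/allP => y /H/negP.
Qed.

(** Passage from full to abbreviated notation: according to the sign of its place, [e] or its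
    negative is an entry. *)
Lemma entry_place x e : x \in Bn n -> exists i : 'I_n,
  (ptval (x^-1%g e) = i.+1%:Z /\ entry x i = ptval e) \/
  (ptval (x^-1%g e) = - i.+1%:Z /\ entry x i = - ptval e).
Proof.
move=> xB; case E : (x^-1%g e) => [i d]; exists i; rewrite /entry.
have {}E : x (i, d) = e by rewrite -E permKV.
rewrite -E; case: d E => _; [right | by left]; split=> //.
have -> : (i, true) = negpt (i, false) by [].
by have /BnP -> := xB; rewrite ptval_neg opprK.
Qed.

Lemma place_entry x (i : 'I_n) : ptval (x^-1%g (x (i, false))) = i.+1%:Z.
Proof. by rewrite permK. Qed.

Lemma entry_inj x (i j : 'I_n) : entry x i = entry x j -> i = j.
Proof. by move=> /ptval_inj/perm_inj[]. Qed.

Lemma entry_injN x (i j : 'I_n) : x \in Bn n -> entry x i <> - entry x j.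
Proof.
move=> xB; rewrite /entry -ptval_neg => /ptval_inj; have /BnP <- := xB.
by move=> /perm_inj.
Qed.

Definition avoids_231 x := forall a b c, ptval a < ptval b < ptval c -> 0 < ptval b ->
  ~ (ptval (x^-1%g b) < ptval (x^-1%g c) < ptval (x^-1%g a)).

Definition avoids_312 x := forall a b c, ptval a < ptval b < ptval c -> 0 < ptval b ->
  ~ (ptval (x^-1%g c) < ptval (x^-1%g a) < ptval (x^-1%g b)).

Lemma sided_true_pattern x : x \in Bn n -> sided true (inv x) <-> avoids_231 x.
Proof.
move=> xB; split=> [xs a b c /andP[ab bc] b0 /andP[pbc pca]|H].
  have xac : inv x a c by rewrite inv_pos // (lt_trans ab).
  have := xs _ _ _ ab bc xac; rewrite /side b0 eqxx inv_pos //; move: pbc; clear; lia.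
apply: sided_half => // a b c ab bc; rewrite /side eqb_id => b0 /andP[_ pca].
apply: contraT => /(ninv_pos bc) pbc; case: (H a b c) => //; first by rewrite ab.
by rewrite pbc.
Qed.

Lemma sided_false_pattern x : x \in Bn n -> sided false (inv x) <-> avoids_312 x.
Proof.
move=> xB; split=> [xs a b c /andP[ab bc] b0 /andP[pca pab]|H].
  have xac : inv x a c by rewrite inv_pos // (lt_trans ab).
  by have := xs _ _ _ ab bc xac; rewrite /side b0 /= inv_pos //; move: pab; clear; lia.
apply: sided_half => // a b c ab bc; rewrite /side => b0 /andP[_ pca].
apply: contraT => /(ninv_pos bc) pbc; case: (H (negpt c) (negpt b) (negpt a)).
- by rewrite !ptval_neg !ltrN2 bc.
- by rewrite ptval_neg; have := @ptval_neq0 _ b; move: b0; clear; lia.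
- by rewrite !pos_neg // !ltrN2 pca.
Qed.

Lemma pats1P x : x \in avoids_all n pats1 <-> x \in Bn n /\ sided true (inv x).
Proof.
split.
  case/avoids_allP => xB H; split=> //; apply/sided_true_pattern => // a b c /andP[ab bc] b0 /andP[pbc pca].
  have A1 (i j : 'I_n) : (i < j)%N -> ~ (entry x i < entry x j < 0).
    move=> ij Hij; case: (H [:: -2; -1]); rewrite ?inE //; apply/contains2P.
    by exists i, j; split=> //; rewrite /std2; move: Hij; clear; lia.
  have A2 (i j : 'I_n) : (i < j)%N -> ~ (0 < - entry x j < entry x i).
    move=> ij Hij; case: (H [:: 2; -1]); rewrite ?inE //; apply/contains2P.
    by exists i, j; split=> //; rewrite /std2; move: Hij; clear; lia.
  have A3 (i j k : 'I_n) : (i < j)%N -> (j < k)%N ->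
      ~ [/\ 0 < entry x k, entry x k < - entry x i & - entry x i < entry x j].
    move=> ij jk [H1 H2 H3]; case: (H [:: -2; 3; 1]); rewrite ?inE //; apply/contains3P.
    by exists i, j, k; split=> //; rewrite /std3 /std2; move: H1 H2 H3; clear; lia.
  have A4 (i j k : 'I_n) : (i < j)%N -> (j < k)%N ->
      ~ [/\ 0 < - entry x i, - entry x i < entry x j & entry x j < - entry x k].
    move=> ij jk [H1 H2 H3]; case: (H [:: -1; 2; -3]); rewrite ?inE //; apply/contains3P.
    by exists i, j, k; split=> //; rewrite /std3 /std2; move: H1 H2 H3; clear; lia.
  have A5 (i j k : 'I_n) : (i < j)%N -> (j < k)%N ->
      ~ [/\ 0 < entry x i, entry x i < entry x j & entry x j < - entry x k].
    move=> ij jk [H1 H2 H3]; case: (H [:: 1; 2; -3]); rewrite ?inE //; apply/contains3P.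
    by exists i, j, k; split=> //; rewrite /std3 /std2; move: H1 H2 H3; clear; lia.
  have A6 (i j k : 'I_n) : (i < j)%N -> (j < k)%N ->
      ~ [/\ 0 < entry x k, entry x k < entry x i & entry x i < entry x j].
    move=> ij jk [H1 H2 H3]; case: (H [:: 2; 3; 1]); rewrite ?inE //; apply/contains3P.
    by exists i, j, k; split=> //; rewrite /std3 /std2; move: H1 H2 H3; clear; lia.
  have [i Hi] := entry_place b xB; have [j Hj] := entry_place c xB; have [k Hk] := entry_place a xB.
  have a0 := @ptval_neq0 _ a; have jk' := @entry_injN x j k xB.
  have ij' := @entry_injN x i j xB; have ij'' := @entry_inj x i j.
  (* With b left and c right of the centre, the opposite order of indices would be the pattern 2
     -1. *)
  have lt_ij : ptval (x^-1%g b) < 0 -> 0 < ptval (x^-1%g c) -> (i < j)%N.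
    move=> pb pc; case: (ltngtP i j) => // [ji|/val_inj E].
      by case: (A2 _ _ ji); move: Hi Hj pb pc b0 bc; clear; lia.
    by rewrite E in Hi; move: Hi Hj pb pc b0 bc; clear; lia.
  have [pb|[pb pc]] : 0 < ptval (x^-1%g c) \/ ptval (x^-1%g c) < 0 /\ ptval (x^-1%g b) < 0.
    by move: pbc Hj; clear; lia.
  - have jk : (j < k)%N by move: Hj Hk pb pca; clear; lia.
    (* For negative a, avoiding 2 -1 forces c < -a. The sign of a and the side of b then select one
       of the four patterns of length three. *)
    have B2 := A2 _ _ jk.
    have [pb'|pb'] : 0 < ptval (x^-1%g b) \/ ptval (x^-1%g b) < 0 by move: Hi; clear; lia.
      have ij : (i < j)%N by move: Hi Hj pb pb' pbc; clear; lia.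
      have B5 := A5 _ _ _ ij jk; have B6 := A6 _ _ _ ij jk.
      case: (ltP 0 (ptval a)) => pa; first by apply: B6; split; move: Hi Hj Hk pb pb' pca ab bc pa; clear; lia.
      by apply: B5; split; move: Hi Hj Hk pb pb' pca ab bc pa B2 b0 jk' a0; clear; lia.
    have ij := lt_ij pb' pb.
    have B3 := A3 _ _ _ ij jk; have B4 := A4 _ _ _ ij jk.
    case: (ltP 0 (ptval a)) => pa; first by apply: B3; split; move: Hi Hj Hk pb pb' pca ab bc pa; clear; lia.
    by apply: B4; split; move: Hi Hj Hk pb pb' pca ab bc pa B2 b0 jk' a0; clear; lia.
  - have ji : (j < i)%N by move: Hi Hj pb pc pbc; clear; lia.
    by case: (A1 _ _ ji); move: Hi Hj pb pc b0 bc; clear; lia.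
case=> xB /(sided_true_pattern xB) H; apply/avoids_allP; split=> // y yP.
pose pl := place_entry x.
have nz (i : 'I_n) : entry x i <> 0 by exact: ptval_neq0.
have pN (i : 'I_n) : ptval (x^-1%g (negpt (x (i, false)))) = - i.+1%:Z by rewrite pos_neg // pl.
have vN (i : 'I_n) : ptval (negpt (x (i, false))) = - entry x i by rewrite ptval_neg.
(* Each pattern yields a forbidden triple of the full notation; in the two patterns of length two it
   has the form (-c, b, c) and (-b, b, c) respectively. *)
move: yP; rewrite !inE; case/or4P => [/eqP->|/eqP->|/eqP->|/or3P[]/eqP->].
- case/contains2P => i [j [ij]]; rewrite /std2 => S.
  case: (H (x (i, false)) (negpt (x (j, false))) (negpt (x (i, false))));
    rewrite ?pN ?vN ?pl -?/(entry x i); move: (nz i) (nz j) ij S; clear; lia.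
- case/contains2P => i [j [ij]]; rewrite /std2 => S.
  case: (H (x (j, false)) (negpt (x (j, false))) (x (i, false)));
    rewrite ?pN ?vN ?pl -?/(entry x i) -?/(entry x j); move: (nz i) (nz j) ij S; clear; lia.
- case/contains3P => i [j [k [ij jk]]]; rewrite /std3 /std2 => S.
  case: (H (x (k, false)) (negpt (x (i, false))) (x (j, false)));
    rewrite ?pN ?vN ?pl -?/(entry x k) -?/(entry x j); move: (nz i) (nz j) (nz k) ij jk S; clear; lia.
- case/contains3P => i [j [k [ij jk]]]; rewrite /std3 /std2 => S.
  case: (H (x (k, false)) (negpt (x (i, false))) (x (j, false)));
    rewrite ?pN ?vN ?pl -?/(entry x k) -?/(entry x j); move: (nz i) (nz j) (nz k) ij jk S; clear; lia.
- case/contains3P => i [j [k [ij jk]]]; rewrite /std3 /std2 => S.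
  case: (H (x (k, false)) (x (i, false)) (x (j, false)));
    rewrite ?pl -?/(entry x k) -?/(entry x j) -?/(entry x i); move: (nz i) (nz j) (nz k) ij jk S; clear; lia.
- case/contains3P => i [j [k [ij jk]]]; rewrite /std3 /std2 => S.
  case: (H (x (k, false)) (x (i, false)) (x (j, false)));
    rewrite ?pl -?/(entry x k) -?/(entry x j) -?/(entry x i); move: (nz i) (nz j) (nz k) ij jk S; clear; lia.
Qed.

Lemma pats2P x : x \in avoids_all n pats2 <-> x \in Bn n /\ sided false (inv x).
Proof.
split.
  case/avoids_allP => xB H; split=> //; apply/sided_false_pattern => // a b c /andP[ab bc] b0 /andP[pca pab].
  have A1 (i j : 'I_n) : (i < j)%N -> ~ (0 < entry x j < - entry x i).
    move=> ij Hij; case: (H [:: -2; 1]); rewrite ?inE //; apply/contains2P.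
    by exists i, j; split=> //; rewrite /std2; move: Hij; clear; lia.
  have A2 (i j : 'I_n) : (i < j)%N -> ~ (0 < entry x i < - entry x j).
    move=> ij Hij; case: (H [:: 1; -2]); rewrite ?inE //; apply/contains2P.
    by exists i, j; split=> //; rewrite /std2; move: Hij; clear; lia.
  have A3 (i j k : 'I_n) : (i < j)%N -> (j < k)%N ->
      ~ [/\ 0 < - entry x j, - entry x j < - entry x i & - entry x i < - entry x k].
    move=> ij jk [H1 H2 H3]; case: (H [:: -2; -1; -3]); rewrite ?inE //; apply/contains3P.
    by exists i, j, k; split=> //; rewrite /std3 /std2; move: H1 H2 H3; clear; lia.
  have A4 (i j k : 'I_n) : (i < j)%N -> (j < k)%N ->
      ~ [/\ 0 < - entry x i, - entry x i < - entry x k & - entry x k < entry x j].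
    move=> ij jk [H1 H2 H3]; case: (H [:: -1; 3; -2]); rewrite ?inE //; apply/contains3P.
    by exists i, j, k; split=> //; rewrite /std3 /std2; move: H1 H2 H3; clear; lia.
  have A5 (i j k : 'I_n) : (i < j)%N -> (j < k)%N ->
      ~ [/\ 0 < - entry x j, - entry x j < entry x k & entry x k < entry x i].
    move=> ij jk [H1 H2 H3]; case: (H [:: 3; -1; 2]); rewrite ?inE //; apply/contains3P.
    by exists i, j, k; split=> //; rewrite /std3 /std2; move: H1 H2 H3; clear; lia.
  have A6 (i j k : 'I_n) : (i < j)%N -> (j < k)%N ->
      ~ [/\ 0 < entry x j, entry x j < entry x k & entry x k < entry x i].
    move=> ij jk [H1 H2 H3]; case: (H [:: 3; 1; 2]); rewrite ?inE //; apply/contains3P.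
    by exists i, j, k; split=> //; rewrite /std3 /std2; move: H1 H2 H3; clear; lia.
  have [i Hi] := entry_place c xB; have [j Hj] := entry_place a xB; have [k Hk] := entry_place b xB.
  have a0 := @ptval_neq0 _ a; have ij' := @entry_injN x i j xB; have jk' := @entry_injN x j k xB.
  have ji' := @entry_injN x j i xB.
  (* The centre of the full notation lies before c, between c and b, or after b. The middle case
     gives the patterns of length two, the outer ones those of length three, selected by the sign of
     a. *)
  have [pc|[[pc pb]|[pc pb]]] : 0 < ptval (x^-1%g c) \/
      (ptval (x^-1%g c) < 0 /\ 0 < ptval (x^-1%g b)) \/
      (ptval (x^-1%g c) < 0 /\ ptval (x^-1%g b) < 0) by move: Hi Hk; clear; lia.
  - have ij : (i < j)%N by move: Hi Hj pc pca; clear; lia.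
    have jk : (j < k)%N by move: Hi Hj Hk pc pca pab; clear; lia.
    case: (ltP 0 (ptval a)) => pa.
      by apply: (A6 _ _ _ ij jk); split; move: Hi Hj Hk pc pca pab ab bc pa; clear; lia.
    have B1 := A1 _ _ jk.
    by apply: (A5 _ _ _ ij jk); split; move: Hi Hj Hk pc pca pab ab bc pa B1 b0 a0 jk'; clear; lia.
  - case: (ltngtP i k) => [ik|ki|/val_inj E].
    + by apply: (A1 _ _ ik); move: Hi Hk pc pb b0 bc; clear; lia.
    + by apply: (A2 _ _ ki); move: Hi Hk pc pb b0 bc; clear; lia.
    + by rewrite -E in Hk; move: Hi Hk pc pb b0 bc; clear; lia.
  - have kj : (k < j)%N by move: Hj Hk pb pab; clear; lia.
    have ji : (j < i)%N by move: Hi Hj pc pab pb pca; clear; lia.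
    case: (ltP 0 (ptval a)) => pa.
      by apply: (A3 _ _ _ kj ji); split; move: Hi Hj Hk pc pb pca pab ab bc pa; clear; lia.
    have B2 := A2 _ _ ji.
    by apply: (A4 _ _ _ kj ji); split; move: Hi Hj Hk pc pb pca pab ab bc pa B2 b0 a0 ji'; clear; lia.
case=> xB /(sided_false_pattern xB) H; apply/avoids_allP; split=> // y yP.
pose pl := place_entry x.
have nz (i : 'I_n) : entry x i <> 0 by exact: ptval_neq0.
have pN (i : 'I_n) : ptval (x^-1%g (negpt (x (i, false)))) = - i.+1%:Z by rewrite pos_neg // pl.
have vN (i : 'I_n) : ptval (negpt (x (i, false))) = - entry x i by rewrite ptval_neg.
move: yP; rewrite !inE; case/or4P => [/eqP->|/eqP->|/eqP->|/or3P[]/eqP->].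
- case/contains2P => i [j [ij]]; rewrite /std2 => S.
  case: (H (x (i, false)) (x (j, false)) (negpt (x (i, false))));
    rewrite ?pN ?vN ?pl -?/(entry x i) -?/(entry x j); move: (nz i) (nz j) ij S; clear; lia.
- case/contains2P => i [j [ij]]; rewrite /std2 => S.
  case: (H (negpt (x (i, false))) (x (i, false)) (negpt (x (j, false))));
    rewrite ?pN ?vN ?pl -?/(entry x i) -?/(entry x j); move: (nz i) (nz j) ij S; clear; lia.
- case/contains3P => i [j [k [ij jk]]]; rewrite /std3 /std2 => S.
  case: (H (negpt (x (j, false))) (negpt (x (i, false))) (negpt (x (k, false))));
    rewrite ?pN ?vN; move: (nz i) (nz j) (nz k) ij jk S; clear; lia.
- case/contains3P => i [j [k [ij jk]]]; rewrite /std3 /std2 => S.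
  case: (H (negpt (x (j, false))) (negpt (x (i, false))) (negpt (x (k, false))));
    rewrite ?pN ?vN; move: (nz i) (nz j) (nz k) ij jk S; clear; lia.
- case/contains3P => i [j [k [ij jk]]]; rewrite /std3 /std2 => S.
  case: (H (x (j, false)) (x (k, false)) (x (i, false)));
    rewrite ?pl -?/(entry x k) -?/(entry x j) -?/(entry x i); move: (nz i) (nz j) (nz k) ij jk S; clear; lia.
- case/contains3P => i [j [k [ij jk]]]; rewrite /std3 /std2 => S.
  case: (H (x (j, false)) (x (k, false)) (x (i, false)));
    rewrite ?pl -?/(entry x k) -?/(entry x j) -?/(entry x i); move: (nz i) (nz j) (nz k) ij jk S; clear; lia.
Qed.

End Patterns.

(** * The quotient lattices *)

Section Quotient.
Variable n : nat.
Implicit Types (a b c e f : pt n) (x y z : {perm pt n}).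

Lemma ThetaP E x y : Theta E x y <-> forall R, cong R -> @contracts_edges n E R -> R x y.
Proof.
split=> [H R RC RE|H R /lat_congP RC RE]; last exact: H.
by apply: H => //; exact/lat_congP.
Qed.

(** Descent on the number of inversions: [not_sided_cover] keeps providing a contracted cover below
    until a sided element is reached. *)
Lemma sided_representative sg y (Q : {perm pt n} -> {perm pt n} -> Prop) :
  (forall x, x \in Bn n -> Q x x) -> (forall x y z, Q x y -> Q y z -> Q x z) ->
  (forall x y a b c, x \in Bn n -> y \in Bn n -> cover x y a c -> side sg b ->
     ptval a < ptval b < ptval c -> ~~ inv y b c -> Q x y) ->
  y \in Bn n -> exists x, [/\ x \in Bn n, sided sg (inv x) & Q x y].
Proof.
move=> Qr Qt Qc; pose I w := [set p : pt n * pt n | inv w p.1 p.2].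
have [N] := ubnP #|I y|; elim: N y => // N IH y yN yB.
have [ys|ys] : sided sg (inv y) \/ ~ sided sg (inv y).
- case: (boolP [forall a, forall b, forall c, (ptval a < ptval b < ptval c) && inv y a c ==>
      if side sg b then inv y b c else inv y a b]) => [/forallP H|H]; [left | right].
    move=> a b c ab bc ac; have /forallP/(_ b)/forallP/(_ c) := H a.
    by rewrite ab bc ac.
  move=> ys; case/negP: H; apply/forallP => a; apply/forallP => b; apply/forallP => c.
  by apply/implyP => /andP[/andP[ab bc] ac]; exact: ys.
- by exists y; split=> //; exact: Qr.
have [x [a [b [c [xB xy sb abc nbc]]]]] := not_sided_cover yB ys.
have [|z [zB zs zx]] := IH x _ xB.
  rewrite -ltnS; apply: leq_trans yN; rewrite ltnS; apply: proper_card.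
  have [ac nac E] := xy; apply/properP; split.
    by apply/subsetP => p; rewrite !inE E => ->.
  by exists (a, c); rewrite !inE /= ?E // orbp_refl orbT.
by exists z; split=> //; apply: Qt zx _; exact: Qc xy sb abc nbc.
Qed.

(** The isomorphism is induced by the identity on [L]. Contracted covers show that every class meets
    [L]; the single congruence [R0], coarser than [Theta] and injective on [L], separates classes.
    Since [L] contains the join of x and y, that join equals y as soon as it is congruent to y. *)
Lemma quotient_iso sg E (L : {set {perm pt n}}) R0 :
  (forall w, w \in L <-> w \in Bn n /\ sided sg (inv w)) ->
  (forall R, cong R -> contracts_edges E R ->
     forall x y a b c, x \in Bn n -> y \in Bn n -> cover x y a c -> side sg b ->
     ptval a < ptval b < ptval c -> ~~ inv y b c -> R x y) ->
  cong R0 -> contracts_edges E R0 -> (forall x y, x \in L -> y \in L -> R0 x y -> x = y) ->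
  iso_to_quot L E.
Proof.
move=> LP contr RC RE sep; have Lsub := sided_sublattice LP.
exists id; split=> [x /LP[]//|y yB|x y xL yL].
  have [|||x [xB xs xy]] := @sided_representative sg y (Theta E) _ _ _ yB.
  - by move=> x xB; apply/ThetaP => R C _; exact: cong_refl.
  - move=> x z t /ThetaP xz /ThetaP zt; apply/ThetaP => R C CE.
    by apply: (cong_trans C) (xz _ C CE) (zt _ C CE).
  - move=> x z a b c xB zB xz sb abc nbc; apply/ThetaP => R C CE.
    exact: contr C CE _ _ _ _ _ xB zB xz sb abc nbc.
  by exists x => //; apply/LP.
have [/LP[xB _] /LP[yB _]] := (xL, yL).
split=> [/(wleP xB yB) xy|[j Hj /ThetaP jy]].
  exists y; first by apply/is_joinP => //; exact: jspec_le.
  by apply/ThetaP => R C _; exact: cong_refl.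
have [[z zL Hz] _] := Lsub.2 x y xL yL.
move/is_joinP: Hj => /(_ xB yB) Hj; move/is_joinP: Hz => /(_ xB yB) Hz.
rewrite -(jspec_uniq Hj Hz) in zL.
have E' := sep _ _ zL yL (jy _ RC RE); rewrite E' in Hj.
by have [_ xy _ _] := Hj; apply/(wleP xB yB).
Qed.

Lemma iso_edges2 : iso_to_quot (avoids_all n pats1) (edges2 n).
Proof.
apply: (@quotient_iso true _ _ (@same_interior n)).
- exact: pats1P.
- move=> R C CE x y a b c xB yB xy; rewrite /side eqb_id.
  exact: cover_contraction C (step_rel_edges2 CE) xB yB xy.
- exact: same_interior_cong.
- exact: same_interior_edges2.
- move=> x y /pats1P[xB xs] /pats1P[yB ys] [_ _ E]; apply: inv_inj => // a c.
  by rewrite -(interior_id xs) E interior_id.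
Qed.

Lemma iso_edges1 : iso_to_quot (avoids_all n pats2) (edges1 n).
Proof.
apply: (@quotient_iso false _ _ (fun x y => same_interior (dual x) (dual y))).
- exact: pats2P.
- move=> R C CE x y a b c xB yB xy sb /andP[ab bc] nbc; have [ac nac E] := xy.
  have xab : inv x a b.
    have /orP[//|xbc] : inv x a b || inv x b c by apply: cover_between xy xB yB _; rewrite ab.
    by move: nbc; rewrite E xbc.
  have xN := bicl_neg (inv_biclosed xB).
  apply: cong_sym => //; rewrite -(dualK x) -(dualK y).
  (* Dualizing reverses the cover: [dual x] covers [dual y] along (-c, -a), with positive middle
     value -b. *)
  apply: (@cover_contraction n _ (dual y) (dual x) (negpt c) (negpt b) (negpt a)
     (cong_dual C) (step_rel_edges1 C CE)); rewrite ?dual_Bn //.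
  + split; first by rewrite !ptval_neg ltrN2.
      by rewrite inv_dual // !ptval_neg ltrN2 ac /= negbK E -orbpN orbp_refl orbT.
    move=> e f; rewrite !inv_dual // E orbpN.
    case: (boolP (orbp a c e f)) => [o|_]; last by rewrite !orbF.
    rewrite !orbT (orbp_lt ac o) /=; move: o nac; rewrite /orbp.
    by move=> /orP[] /andP[/eqP-> /eqP->] //; apply: contra => /xN; rewrite !negptK.
  + by move: sb; rewrite /side ptval_neg; have := @ptval_neq0 _ b; clear; lia.
  + by rewrite !ptval_neg !ltrN2 bc.
  + by rewrite inv_dual // !ptval_neg ltrN2 ab /= negbK; exact: xN.
- exact: cong_dual (@same_interior_cong n).
- exact: same_interior_edges1.
- move=> x y /pats2P[xB xs] /pats2P[yB ys] [_ _ E]; exact: dual_interior_inj E.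
Qed.

End Quotient.

Theorem theorem7p8 (n : nat) (hn : (2 <= n)%N) :
  sublattice (avoids_all n pats1) /\ sublattice (avoids_all n pats2) /\
  ((iso_to_quot (avoids_all n pats1) (edges1 n) /\
    iso_to_quot (avoids_all n pats2) (edges2 n)) \/
   (iso_to_quot (avoids_all n pats1) (edges2 n) /\
    iso_to_quot (avoids_all n pats2) (edges1 n))).
Proof.
split; first exact: sided_sublattice (@pats1P n).
split; first exact: sided_sublattice (@pats2P n).
by right; split; [exact: iso_edges2 | exact: iso_edges1].
Qed.
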